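(* Let $(\mathcal{X},d)$ be a compact metric space, $T:\mathcal{X}\to\mathcal{X}$ a continuous map, and $\mu$ an ergodic $T$-invariant Borel probability measure on $\mathcal{X}$. Then for every $\delta\in(0,1)$, $$h_\mu(T)=\lim_{\epsilon\to 0}R_\mu(\epsilon)=\widetilde{h}_\mu(T,\delta).$$
   Context: $h_\mu(T)$ is the measure-theoretic (Kolmogorov–Sinai) entropy of $\mu$. Average dynamical quantities: for $n\ge1$ let $\widetilde{d}_n(x,y)=\frac1n\sum_{k=0}^{n-1}d(T^kx,T^ky)$; an $(n,\epsilon)$-average dynamical ball is a ball of radius $\epsilon$ in the metric $\widetilde{d}_n$. For $\delta\in(0,1)$, $\widetilde{N}_\mu(n,\epsilon,\delta)$ is the minimum number of $(n,\epsilon)$-average dynamical balls needed to cover a set of $\mu$-measure strictly bigger than $1-\delta$; $\widetilde{h}_\mu(\epsilon,T,\delta)=\limsup_{n\to\infty}\frac1n\log\widetilde{N}_\mu(n,\epsilon,\delta)$ and $\widetilde{h}_\mu(T,\delta)=\lim_{\epsilon\to0}\widetilde{h}_\mu(\epsilon,T,\delta)$. Rate distortion function: for $n\ge 1$, $\epsilon>0$, a pair $(X,Y)$ satisfies condition $( * )_{n,\epsilon,\mu}$ if there is a probability space $(\Omega,\mathbb{P})$ such that $X:\Omega\to\mathcal{X}$ and $Y=(Y_0,\dots,Y_{n-1}):\Omega\to\mathcal{X}^n$ are measurable, $X_*\mathbb{P}=\mu$, and $\mathbb{E}\big(\frac1n\sum_{k=0}^{n-1}d(T^kX,Y_k)\big)\le\epsilon$.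 Then $$R_\mu(\epsilon)=\inf\frac1n I(X,Y),$$ the infimum being over all $n\ge1$ and all pairs $(X,Y)$ satisfying $( * )_{n,\epsilon,\mu}$. Here $I(X,Y)$ is the mutual information: for random variables $Z_1,Z_2$ with finite image, $I(Z_1,Z_2)=H(Z_1)+H(Z_2)-H(Z_1,Z_2)$ with $H$ the Shannon entropy, and in general $I(X,Y)$ is the supremum of $I(\alpha\circ X,\beta\circ Y)$ over measurable maps $\alpha,\beta$ with finite image. *)

(* Defs.v *)
From HB Require Import structures.
From mathcomp Require Import all_boot all_order all_algebra.
From mathcomp Require Import all_classical all_reals all_analysis.

Set Implicit Arguments.
Unset Strict Implicit.
Unset Printing Implicit Defensive.
Import Order.TTheory GRing.Theory Num.Theory.
Import numFieldNormedType.Exports.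

Local Open Scope classical_set_scope.
Local Open Scope ring_scope.

(* Metric spaces carrying a sigma-algebra.  The structure does not relate the
   two: that the sigma-algebra is the Borel one is the predicate [borel]. *)
#[short(type="measurableMetricType")]
HB.structure Definition MeasurableMetric (d : measure_display)
    (K : numDomainType) :=
  {X of Metric K X & Measurable d X}.

Definition borel (R : realType) (d : measure_display)
    (X : measurableMetricType d R) : Prop :=
  @measurable d X = <<s @open X >>.

Section entropy.
Context {R : realType}.

(* Measurability of a map into a finite set with its discrete sigma-algebra. *)
Definition finite_measurable (d : measure_display) (S : measurableType d)
    (A : finType) (f : S -> A) : Prop :=
  forall a : A, measurable (f @^-1` [set a]).

(* Entropy in nats; the convention 0 log 0 = 0 holds because of the factor p. *)
Definition shannon_entropy (d : measure_display) (O : measurableType d)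
    (P : probability O R) (A : finType) (Z : O -> A) : R :=
  - \sum_(a : A) (let p := fine (P (Z @^-1` [set a])) in p * ln p).

Definition finite_mutual_info (d : measure_display) (O : measurableType d)
    (P : probability O R) (A B : finType) (Z1 : O -> A) (Z2 : O -> B) : R :=
  shannon_entropy P Z1 + shannon_entropy P Z2
  - shannon_entropy P (fun w => (Z1 w, Z2 w)).

Definition mutual_info (d d1 d2 : measure_display) (O : measurableType d)
    (P : probability O R) (S1 : measurableType d1) (S2 : measurableType d2)
    (X : O -> S1) (Y : O -> S2) : \bar R :=
  ereal_sup [set r | exists (A B : finType) (f : S1 -> A) (g : S2 -> B),
    [/\ finite_measurable f, finite_measurable g &
        r = (finite_mutual_info P (f \o X) (g \o Y))%:E]].

End entropy.

Section measure_preserving_systems.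
Context {R : realType} {d : measure_display} {X : measurableType d}.
Variables (mu : probability X R) (T : X -> X).

Definition invariant_measure : Prop :=
  forall A : set X, measurable A -> mu (T @^-1` A) = mu A.

Definition ergodic_measure : Prop :=
  forall A : set X, measurable A -> T @^-1` A = A ->
    mu A = 0%E \/ mu A = 1%E.

(* A finite measurable partition is given by a labelling f : X -> A; the
   itinerary of length n labels the join of the partitions T^{-k}(f), k < n. *)
Definition itinerary (A : finType) (f : X -> A) (n : nat) (x : X) :
    {ffun 'I_n -> A} :=
  [ffun k : 'I_n => f (iter k T x)].

Definition partition_entropy (A : finType) (f : X -> A) : \bar R :=
  limn (fun n : nat => (n%:R^-1 * shannon_entropy mu (itinerary f n))%:E).

Definition ks_entropy : \bar R :=
  ereal_sup [set r | exists (A : finType) (f : X -> A),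
    finite_measurable f /\ r = partition_entropy f].

End measure_preserving_systems.

Section average_dynamical_quantities.
Context {R : realType} {d : measure_display} {X : measurableMetricType d R}.
Variables (mu : probability X R) (T : X -> X).

Definition avg_dist (n : nat) (x y : X) : R :=
  n%:R^-1 * \sum_(k < n) mdist (iter k T x) (iter k T y).

Definition avg_ball (n : nat) (x : X) (eps : R) : set X :=
  [set y | avg_dist n x y < eps].

(* s lists the centres of the balls. *)
Definition avg_covering (n : nat) (eps delta : R) (s : seq X) : Prop :=
  exists A : set X, [/\ measurable A, ((1 - delta)%:E < mu A)%E &
    A `<=` \bigcup_(x in [set` s]) avg_ball n x eps].

Definition avg_covering_number (n : nat) (eps delta : R) : \bar R :=
  ereal_inf [set (size s)%:R%:E | s in avg_covering n eps delta].

Definition avg_entropy (delta eps : R) : \bar R :=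
  limn_esup (fun n : nat =>
    (n%:R^-1)%:E * lne (avg_covering_number n eps delta))%E.

(* The law of X0 is compared with mu on measurable sets only, since measures
   are unconstrained elsewhere. *)
Definition distortion_pair (n : nat) (eps : R) (dO : measure_display)
    (O : measurableType dO) (P : probability O R)
    (X0 : {mfun O >-> X}) (Y : {mfun O >-> n.-tuple X}) : Prop :=
  (forall A : set X, measurable A -> distribution P X0 A = mu A) /\
  ('E_P[fun w => (n%:R^-1 *
      \sum_(k < n) mdist (iter k T (X0 w)) (tnth (Y w) k))%R] <= eps%:E)%E.

Definition rate_distortion (eps : R) : \bar R :=
  ereal_inf [set r | exists (n : nat) (dO : measure_display)
      (O : measurableType dO) (P : probability O R)
      (X0 : {mfun O >-> X}) (Y : {mfun O >-> n.-tuple X}),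
    [/\ (0 < n)%N, distortion_pair eps P X0 Y &
        r = ((n%:R^-1)%:E * mutual_info P X0 Y)%E]].

End average_dynamical_quantities.

(* Main.v *)
Require Import Defs.
From HB Require Import structures.
From mathcomp Require Import all_boot all_order all_algebra.
From mathcomp Require Import all_classical all_reals all_analysis.
From mathcomp Require Import measurable_realfun ring lra.
Import Order.TTheory GRing.Theory Num.Theory.
Import numFieldNormedType.Exports.
Local Open Scope classical_set_scope.
Local Open Scope ring_scope.

Set Implicit Arguments.
Unset Strict Implicit.
Unset Printing Implicit Defensive.

(** Both limits are computed by coding.  A cost on a finite set of words is a
function [c] that satisfies Kraft's inequality, that is, the sum of the
weights [expR (- c w)] is at most 1.  Two facts are used all the time: the
entropy of a random word is at most its mean cost, also conditionally
([conditional_entropy_le_cost], [entropy_le_cost]), and there are at most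
[expR K] words of cost at most [K] ([card_le_cost]).

Let [f] be a finite partition, [H n] the entropy of its itineraries of length
[n], and [h] the infimum of the increments [H n.+1 - H n].  An increment close
to [h] is the mean cost of one letter for a Markov code.  For this code the
cost of the itinerary of [x] is at most a constant plus a Birkhoff sum of a bounded
function [g] of mean close to [h] ([markov_code]).  Hence [H n] lies between
[n * h] and [C + n * (h + eta)], so that [h] is the entropy of the partition
([partition_entropyE]).  Moreover, by ergodicity, the cost exceeds
[C + n * (h + eta)] only on a set of small measure: this is the one-sided ergodic
theorem [birkhoff_sum_deviation], which follows from Garsia's maximal
inequality.

The theorem then amounts to two upper bounds for a partition whose cells are
small, and to two lower bounds for an arbitrary partition.

- Rate distortion, upper bound.  Replacing each point of an orbit by a chosen
  point of its cell gives a small distortion, and at most the entropy of the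
  itinerary as information ([rate_distortion_le_rate]).
- Covering numbers, upper bound.  Choose one centre for each word of cost at
  most [n * (h + eta)] ([avg_entropy_le_rate]).
- Rate distortion, lower bound.  Up to a set of small measure the label of a
  point can be read off every point close to it ([robust_labelling]).  So the
  itinerary of [X0] can be guessed from [Y] with few errors, and correcting
  errors is cheap ([mismatch_cost]): the conditional entropy of the itinerary
  given [Y] is small ([rate_distortion_ge]).
- Covering numbers, lower bound.  Suppose that [N] average balls cover a set
  of measure [a].  Code a point of this set by the centre of its ball and by
  corrections, at a cost of about [ln N], and any other point by the Markov
  code, at a cost of about [n * h].  The mean cost is at least [n * h], so
  that [a * ln N] is at least about [a * n * h].  As [a] stays away from 0,
  this holds for every [delta] ([avg_entropy_ge]).

The upper bounds hold at every scale and the lower bounds at all small scales,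
so that both quantities converge to the supremum of the entropies of the
partitions ([cvg_ereal_sup_at_right]). *)

(** * Bounded measurable functions on a probability space *)

Section bounded_expectation.
Context {R : realType} {d : measure_display} {O : measurableType d}.
Variable P : probability O R.

Definition bounded_measurable (F : O -> R) : Prop :=
  measurable_fun setT F /\ exists M, forall x, `|F x| <= M.

Definition prob (A : set O) : R := fine (P A).

Definition mean (F : O -> R) : R := \int[P]_x F x.

Lemma prob_fin (A : set O) : measurable A -> P A = (prob A)%:E.
Proof. by move=> mA; rewrite /prob fineK// fin_num_measure. Qed.

Lemma prob_ge0 (A : set O) : 0 <= prob A.
Proof. exact: fine_ge0. Qed.

Lemma probT : prob setT = 1.
Proof. by rewrite /prob probability_setT. Qed.

Lemma prob_le (A B : set O) : measurable A -> measurable B -> A `<=` B ->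
  prob A <= prob B.
Proof.
move=> mA mB AB; rewrite -lee_fin -!prob_fin//.
by apply: le_measure => //; rewrite inE.
Qed.

Lemma prob_le1 (A : set O) : measurable A -> prob A <= 1.
Proof. by move=> mA; rewrite -probT; apply: prob_le. Qed.

Lemma probC (A : set O) : measurable A -> prob (~` A) = 1 - prob A.
Proof.
move=> mA; apply: EFin_inj; rewrite -prob_fin; last exact: measurableC.
by rewrite probability_setC// prob_fin// EFinB.
Qed.

Lemma probU_le (A B : set O) : measurable A -> measurable B ->
  prob (A `|` B) <= prob A + prob B.
Proof.
move=> mA mB; rewrite -lee_fin EFinD -!prob_fin//; last exact: measurableU.
exact: measureU2.
Qed.

Lemma bm_cst c : bounded_measurable (cst c).
Proof. by split; [exact: measurable_cst|exists `|c|]. Qed.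

Lemma bm_add F G : bounded_measurable F -> bounded_measurable G ->
  bounded_measurable (fun x => F x + G x).
Proof.
move=> [mF [M FM]] [mG [N GN]]; split; first exact: measurable_funD.
by exists (M + N) => x; rewrite (le_trans (ler_normD _ _))// lerD.
Qed.

Lemma bm_mul F G : bounded_measurable F -> bounded_measurable G ->
  bounded_measurable (fun x => F x * G x).
Proof.
move=> [mF [M FM]] [mG [N GN]]; split; first exact: measurable_funM.
by exists (M * N) => x; rewrite normrM ler_pM.
Qed.

Lemma bm_scale c F : bounded_measurable F ->
  bounded_measurable (fun x => c * F x).
Proof. by move=> bF; exact: bm_mul (bm_cst c) bF. Qed.

Lemma bm_max F G : bounded_measurable F -> bounded_measurable G ->
  bounded_measurable (fun x => Num.max (F x) (G x)).
Proof.
move=> [mF [M FM]] [mG [N GN]]; split; first exact: measurable_maxr.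
exists (Num.max M N) => x; rewrite le_max.
by rewrite /Num.max; case: ifP => _; rewrite ?FM ?GN ?orbT.
Qed.

Lemma bm_indic (A : set O) : measurable A -> bounded_measurable (\1_A).
Proof.
move=> mA; split; first exact: measurable_indic.
by exists 1 => x; rewrite indicE; case: (_ \in _); rewrite ?normr1 ?normr0.
Qed.

Lemma bm_sum (I : Type) (r : seq I) (F : I -> O -> R) :
  (forall i, bounded_measurable (F i)) ->
  bounded_measurable (fun x => \sum_(i <- r) F i x).
Proof.
move=> bF; elim: r => [|i r IH].
  by under eq_fun do rewrite big_nil; exact: bm_cst.
by under eq_fun do rewrite big_cons; exact: bm_add.
Qed.

Lemma bm_integrable F : bounded_measurable F ->
  P.-integrable setT (EFin \o F).
Proof.
move=> [mF [M FM]]; apply: measurable_bounded_integrable => //.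
  by rewrite -ge0_fin_numE ?fin_num_measure.
by exists M; split; [exact: num_real|move=> N MN x _ /=; rewrite (le_trans (FM x)) ?ltW].
Qed.

Lemma mean_add F G : bounded_measurable F -> bounded_measurable G ->
  mean (fun x => F x + G x) = mean F + mean G.
Proof. by move=> bF bG; rewrite /mean RintegralD//; exact: bm_integrable. Qed.

Lemma mean_scale c F : bounded_measurable F ->
  mean (fun x => c * F x) = c * mean F.
Proof. by move=> bF; rewrite /mean RintegralZl//; exact: bm_integrable. Qed.

Lemma mean_cst c : mean (cst c) = c.
Proof. by rewrite /mean Rintegral_cst// -/(prob setT) probT mulr1. Qed.

Lemma mean_indic (A : set O) : measurable A -> mean (\1_A) = prob A.
Proof. by move=> mA; rewrite /mean /Rintegral integral_indic// setIT. Qed.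

Lemma mean_le F G : bounded_measurable F -> bounded_measurable G ->
  (forall x, F x <= G x) -> mean F <= mean G.
Proof.
by move=> bF bG FG; apply: le_Rintegral => //; exact: bm_integrable.
Qed.

Lemma mean_sum (I : Type) (r : seq I) (F : I -> O -> R) :
  (forall i, bounded_measurable (F i)) ->
  mean (fun x => \sum_(i <- r) F i x) = \sum_(i <- r) mean (F i).
Proof.
move=> bF; elim: r => [|i r IH].
  by rewrite big_nil; under eq_fun do rewrite big_nil; exact: mean_cst.
rewrite big_cons -IH -mean_add//; last exact: bm_sum.
by congr mean; apply/funext => x; rewrite big_cons.
Qed.

(** The integral of a nonnegative function is defined as a supremum over the
simple functions below it, and is therefore monotone for arbitrary functions.
This is applied to the distance between two random points. *)
Lemma le_expectation (F G : O -> R) :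
  (forall x, 0 <= F x) -> (forall x, F x <= G x) -> ('E_P[F] <= 'E_P[G])%E.
Proof.
move=> F0 FG; have G0 x : 0 <= G x by rewrite (le_trans (F0 x)).
rewrite unlock !ge0_integralTE => [|x|x]; rewrite ?lee_fin//.
apply: ereal_sup_le => _ [h hF <-]; exists h => // x.
by rewrite (le_trans (hF x))// lee_fin.
Qed.

Lemma expectation_mean F : bounded_measurable F -> ('E_P[F] = (mean F)%:E)%E.
Proof.
move=> bF; rewrite unlock /mean /Rintegral fineK//.
by apply: integrable_fin_num => //; exact: bm_integrable.
Qed.

End bounded_expectation.

Lemma bm_comp (R : realType) d d' (O : measurableType d) (O' : measurableType d')
    (T : O -> O') (F : O' -> R) : measurable_fun setT T ->
  bounded_measurable F -> bounded_measurable (F \o T).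
Proof.
move=> mT [mF [M FM]]; split; first exact: measurableT_comp.
by exists M => x /=.
Qed.

(** * Shannon entropy of finite-valued random variables *)

Section finite_variables.
Context {R : realType} {d : measure_display} {O : measurableType d}.
Implicit Types A B : finType.

Lemma finite_measurable_preimage A (Z : O -> A) (S : set A) :
  finite_measurable Z -> measurable (Z @^-1` S).
Proof.
move=> mZ; have -> : Z @^-1` S = \bigcup_(a in S) Z @^-1` [set a].
  by apply/seteqP; split => [x Sx|x [a Sa /= ->]]//; exists (Z x).
by apply: fin_bigcup_measurable => // a _; exact: mZ.
Qed.

Lemma finite_measurable_asbool (S : set O) : measurable S ->
  finite_measurable (fun x => `[< S x >]).
Proof.
move=> mS [].
  rewrite (_ : _ @^-1` _ = S)//.
  by apply/seteqP; split => y /= /asboolP.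
rewrite (_ : _ @^-1` _ = ~` S); first exact: measurableC.
by apply/seteqP; split => y /= => [/asboolPn|/asboolPn/negbTE].
Qed.

Lemma finite_measurable_comp A B (Z : O -> A) (phi : A -> B) :
  finite_measurable Z -> finite_measurable (phi \o Z).
Proof.
by move=> mZ b; exact: (finite_measurable_preimage (phi @^-1` [set b])).
Qed.

Lemma finite_measurable_pair A B (Z : O -> A) (W : O -> B) :
  finite_measurable Z -> finite_measurable W ->
  finite_measurable (fun x => (Z x, W x)).
Proof.
move=> mZ mW [a b].
rewrite (_ : _ @^-1` _ = Z @^-1` [set a] `&` W @^-1` [set b]).
  exact: measurableI.
by apply/seteqP; split => x /= => [[-> ->]|[-> ->]].
Qed.

Lemma finite_measurable_ffun (I : finType) A (Z : I -> O -> A) :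
  (forall k, finite_measurable (Z k)) ->
  finite_measurable (fun x => [ffun k => Z k x]).
Proof.
move=> mZ w.
rewrite (_ : _ @^-1` _ = \bigcap_(k in [set: I]) Z k @^-1` [set w k]).
  by apply: fin_bigcap_measurable => // k _; exact: mZ.
apply/seteqP; split => x /= => [<- k _ /=|Zw]; first by rewrite ffunE.
by apply/ffunP => k; rewrite ffunE; exact: Zw.
Qed.

Section law.
Variable P : probability O R.

Definition law A (Z : O -> A) (a : A) : R := prob P (Z @^-1` [set a]).

Lemma law_ge0 A (Z : O -> A) a : 0 <= law Z a.
Proof. exact: prob_ge0. Qed.

Lemma bm_finite A (Z : O -> A) (F : A -> R) :
  finite_measurable Z -> bounded_measurable (fun x => F (Z x)).
Proof.
move=> mZ; split.
  by move=> _ S mS; rewrite setTI; exact: (finite_measurable_preimage (F @^-1` S)).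
exists (\sum_a `|F a|) => x.
by rewrite (bigD1 (Z x))//= lerDl sumr_ge0.
Qed.

Lemma mean_finite A (Z : O -> A) (F : A -> R) : finite_measurable Z ->
  mean P (fun x => F (Z x)) = \sum_a law Z a * F a.
Proof.
move=> mZ; have mI a : measurable (Z @^-1` [set a]) by exact: mZ.
transitivity (mean P (fun x => \sum_a F a * \1_(Z @^-1` [set a]) x)).
  congr mean; apply/funext => x; rewrite (bigD1 (Z x))//= indicE mem_set//.
  rewrite mulr1 big1 ?addr0// => a aZ; rewrite indicE memNset ?mulr0//=.
  by move/esym => aE; rewrite aE eqxx in aZ.
rewrite mean_sum => [|a]; last by apply: bm_scale; exact: bm_indic.
apply: eq_bigr => a _; rewrite mean_scale; last exact: bm_indic.
by rewrite mean_indic// mulrC.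
Qed.

Lemma law_sum A (Z : O -> A) : finite_measurable Z -> \sum_a law Z a = 1.
Proof.
move=> mZ; rewrite -(mean_cst P 1) (mean_finite (fun=> 1) mZ).
by apply: eq_bigr => a _; rewrite mulr1.
Qed.

Lemma law_comp A B (Z : O -> A) (phi : A -> B) b : finite_measurable Z ->
  law (phi \o Z) b = \sum_(a | phi a == b) law Z a.
Proof.
move=> mZ; rewrite /law -mean_indic; last exact: finite_measurable_comp.
rewrite (_ : \1__ = fun x => (phi (Z x) == b)%:R); last first.
  apply/funext => x; rewrite indicE; congr (_%:R); congr nat_of_bool.
  by apply/idP/eqP => [/set_mem|?]//; exact/mem_set.
rewrite (mean_finite (fun a => (phi a == b)%:R) mZ) [RHS]big_mkcond.
by apply: eq_bigr => a _; case: ifP; rewrite (mulr1, mulr0).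
Qed.

Lemma law_le_comp A B (Z : O -> A) (phi : A -> B) a : finite_measurable Z ->
  law Z a <= law (phi \o Z) (phi a).
Proof.
move=> mZ; rewrite law_comp// (bigD1 a)//= lerDl sumr_ge0// => *.
exact: law_ge0.
Qed.

Lemma entropyE A (Z : O -> A) : finite_measurable Z ->
  shannon_entropy P Z = mean P (fun x => - ln (law Z (Z x))).
Proof.
move=> mZ; rewrite (mean_finite (fun a => - ln (law Z a)) mZ) /shannon_entropy.
by rewrite -sumrN; apply: eq_bigr => a _; rewrite mulrN.
Qed.

Lemma entropy_comp_le A B (Z : O -> A) (phi : A -> B) : finite_measurable Z ->
  shannon_entropy P (phi \o Z) <= shannon_entropy P Z.
Proof.
move=> mZ; have mphiZ := finite_measurable_comp phi mZ.
rewrite !entropyE//= (mean_finite (fun a => - ln (law (phi \o Z) (phi a))) mZ).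
rewrite (mean_finite (fun a => - ln (law Z a)) mZ); apply: ler_sum => a _.
have := law_ge0 Z a; rewrite le_eqVlt => /predU1P[<-|p0]; first by rewrite !mul0r.
have pp := law_le_comp phi a mZ.
by rewrite ler_pM2l// lerN2 ler_ln// posrE (lt_le_trans p0).
Qed.

(** The inequality [ln r <= r - 1], applied to the ratio between the joint
law of [(Z, W)] and the sub-law with weights [law W b * expR (- c a b)].
A cost [c] that satisfies Kraft's inequality for every value of [W] is thus
an upper bound for the conditional entropy of [Z] given [W]. *)
Lemma conditional_entropy_le_cost A B (Z : O -> A) (W : O -> B)
    (c : A -> B -> R) :
  finite_measurable Z -> finite_measurable W ->
  (forall b, \sum_a expR (- c a b) <= 1) ->
  shannon_entropy P (fun x => (Z x, W x)) <=
    shannon_entropy P W + mean P (fun x => c (Z x) (W x)).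
Proof.
move=> mZ mW kraft; have mZW := finite_measurable_pair mZ mW.
rewrite (entropyE mZW) (entropyE mW).
pose p ab := law (fun x => (Z x, W x)) ab.
pose F (ab : A * B) := - ln (p ab) + (-1) * (- ln (law W ab.2) + c ab.1 ab.2).
rewrite -subr_le0 -mean_add; last 2 first.
- exact: (bm_finite (fun b => - ln (law W b)) mW).
- exact: (bm_finite (fun ab => c ab.1 ab.2) mZW).
rewrite -mulN1r -mean_scale; last first.
  exact: (bm_finite (fun ab => - ln (law W ab.2) + c ab.1 ab.2) mZW).
rewrite -mean_add; last 2 first.
- exact: (bm_finite (fun ab => - ln (p ab)) mZW).
- exact: (bm_finite (fun ab => -1 * (- ln (law W ab.2) + c ab.1 ab.2)) mZW).
rewrite (mean_finite F mZW).
pose G ab := law W ab.2 * expR (- c ab.1 ab.2) - p ab.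
apply: (@le_trans _ _ (\sum_ab G ab)).
  apply: ler_sum => -[a b] _; rewrite -/(p (a, b)) /F /G /=.
  have := law_ge0 (fun x => (Z x, W x)) (a, b); rewrite -/(p _).
  rewrite le_eqVlt => /predU1P[<-|p0].
    by rewrite mul0r subr0 mulr_ge0 ?expR_ge0// law_ge0.
  have W0 : 0 < law W b by rewrite (lt_le_trans p0)//; exact: (law_le_comp snd).
  set r := law W b * expR (- c a b) / p (a, b).
  have r0 : 0 < r by rewrite divr_gt0// mulr_gt0// expR_gt0.
  have -> : - ln (p (a, b)) + -1 * (- ln (law W b) + c a b) = ln r.
    rewrite /r ln_div ?posrE ?mulr_gt0 ?expR_gt0//.
    by rewrite lnM ?posrE ?expR_gt0// expRK; ring.
  have -> : law W b * expR (- c a b) - p (a, b) = p (a, b) * (r - 1).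
    by rewrite /r; field; rewrite gt_eqF.
  rewrite ler_pM2l//; rewrite -[X in ln X](addrNK 1) addrC le_ln1Dx//.
  by rewrite ltrBDl subrr.
rewrite sumrB (law_sum mZW) subr_le0 -(pair_bigA _ (fun a b =>
  law W b * expR (- c a b)))/= exchange_big/= -(law_sum mW).
by apply: ler_sum => b _; rewrite -mulr_sumr ler_piMr// law_ge0.
Qed.

Lemma entropy_le_cost A (Z : O -> A) (c : A -> R) : finite_measurable Z ->
  \sum_a expR (- c a) <= 1 ->
  shannon_entropy P Z <= mean P (fun x => c (Z x)).
Proof.
move=> mZ kraft.
have mtt : finite_measurable (fun _ : O => tt).
  by move=> [] /=; rewrite preimage_cst mem_set.
have -> : mean P (fun x => c (Z x)) =
    shannon_entropy P (fun _ : O => tt) + mean P (fun x => c (Z x)).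
  rewrite entropyE// [X in X + _](_ : _ = 0) ?add0r//.
  rewrite -[RHS](mean_cst P); congr mean; apply/funext => x; rewrite /law.
  by rewrite [X in prob P X](_ : _ = setT) ?probT ?ln1 ?oppr0//; apply/seteqP.
apply: le_trans (conditional_entropy_le_cost (c := fun a _ => c a) mZ mtt _) => //.
exact: (@entropy_comp_le _ _ (fun x => (Z x, tt)) fst
  (finite_measurable_pair mZ mtt)).
Qed.

End law.
End finite_variables.

Lemma eq_entropy (R : realType) d d' (O : measurableType d)
    (O' : measurableType d') (P : probability O R) (P' : probability O' R)
    (A : finType) (Z : O -> A) (Z' : O' -> A) :
  (forall a, P (Z @^-1` [set a]) = P' (Z' @^-1` [set a])) ->
  shannon_entropy P Z = shannon_entropy P' Z'.
Proof.
by move=> PP'; rewrite /shannon_entropy; congr (- _); apply: eq_bigr => a _; rewrite PP'.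
Qed.

(** * A one-sided ergodic theorem *)

Lemma prob_nonincreasing_small (R : realType) d (O : measurableType d)
    (P : probability O R) (B : nat -> set O) (tau : R) :
  (forall n, measurable (B n)) -> (forall n, B n.+1 `<=` B n) ->
  P (\bigcap_n B n) = 0%E -> 0 < tau -> exists n, prob P (B n) < tau.
Proof.
move=> mB decB B0 tau0.
have cvgB : P \o B @ \oo --> 0%E.
  rewrite -B0; apply: nonincreasing_cvg_mu => //.
  - by rewrite -ge0_fin_numE ?fin_num_measure.
  - exact: bigcapT_measurable.
  - by apply/nonincreasing_seqP => n; apply/subsetPset/decB.
have /fine_cvgP[_ cvgpB] := cvgB.
have [n _ /(_ n (leqnn n)) Bn] := cvgr_lt _ cvgpB tau tau0.
by exists n.
Qed.

Section ergodic.
Context {R : realType} {d : measure_display} {X : measurableType d}.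
Variables (mu : probability X R) (T : X -> X).
Hypothesis mT : measurable_fun setT T.
Hypothesis invT : invariant_measure mu T.

Definition birkhoff_sum (g : X -> R) (n : nat) (x : X) : R :=
  \sum_(k < n) g (iter k T x).

Lemma measurable_iter k : measurable_fun setT (iter k T).
Proof. by elim: k => [|k IH] /=; [exact: measurable_id|exact: (measurableT_comp mT IH)]. Qed.

Lemma birkhoff_sumS g n x :
  birkhoff_sum g n.+1 x = g x + birkhoff_sum g n (T x).
Proof.
rewrite /birkhoff_sum big_ord_recl; congr +%R.
by apply: eq_bigr => k _; rewrite -iterSr.
Qed.

Lemma bm_birkhoff_sum g n : bounded_measurable g ->
  bounded_measurable (birkhoff_sum g n).
Proof.
move=> bg; rewrite /birkhoff_sum; apply: bm_sum => k.
exact: (bm_comp (measurable_iter k)).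
Qed.

Lemma mean_shift F : bounded_measurable F -> mean mu (F \o T) = mean mu F.
Proof.
move=> bF; have [mF _] := bF.
have bFT := bm_comp mT bF.
pose Tm : {mfun X >-> X} := HB.pack T (isMeasurableFun.Build _ _ _ _ T mT).
rewrite /mean /Rintegral; congr fine.
rewrite [RHS](@eq_measure_integral _ _ _ _ (pushforward mu Tm)); last first.
  by move=> A mA _; rewrite /= /pushforward invT.
rewrite integral_pushforward//.
  exact/measurable_EFinP.
exact: (bm_integrable mu bFT).
Qed.

Lemma mean_iter F k : bounded_measurable F ->
  mean mu (fun x => F (iter k T x)) = mean mu F.
Proof.
move=> bF; elim: k => [//|k IH]; rewrite -{}IH.
rewrite -(mean_shift (bm_comp (measurable_iter k) bF)).
by congr mean; apply/funext => x /=; rewrite -iterSr.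
Qed.

Lemma mean_birkhoff_sum g n : bounded_measurable g ->
  mean mu (birkhoff_sum g n) = n%:R * mean mu g.
Proof.
move=> bg; rewrite /birkhoff_sum mean_sum => [|k]; last first.
  exact: (bm_comp (measurable_iter k)).
rewrite (eq_bigr (fun=> mean mu g)) => [|k _]; last exact: mean_iter.
by rewrite sumr_const card_ord mulr_natl.
Qed.

(** [max_sum g N x] is the largest of [0] and the first [N] Birkhoff sums;
this recursion makes both the maximal inequality and the invariance of the
set where these maxima are unbounded immediate. *)
Fixpoint max_sum (g : X -> R) (N : nat) (x : X) : R :=
  if N is N'.+1 then Num.max 0 (g x + max_sum g N' (T x)) else 0.

Lemma max_sum_ge0 g N x : 0 <= max_sum g N x.
Proof. by case: N => [|N] //=; rewrite le_max lexx. Qed.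

Lemma bm_max_sum g N : bounded_measurable g ->
  bounded_measurable (max_sum g N).
Proof.
move=> bg; elim: N => [|N IH] /=; first exact: bm_cst.
apply: bm_max; first exact: bm_cst.
exact: (bm_add bg (bm_comp mT IH)).
Qed.

Lemma max_sum_nondecreasing g N x : max_sum g N x <= max_sum g N.+1 x.
Proof.
elim: N x => [|N IH] x; first by rewrite max_sum_ge0.
have /= IHx := IH (T x).
by rewrite ge_max !le_max lexx lerD2l IHx orbT.
Qed.

Lemma birkhoff_sum_le_max_sum g N x : birkhoff_sum g N x <= max_sum g N x.
Proof.
elim: N x => [|N IH] x; first by rewrite /birkhoff_sum big_ord0.
by rewrite birkhoff_sumS /= le_max lerD2l IH orbT.
Qed.

(** Garsia's argument: where [max_sum g N.+1] is positive, it is at most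
[g + max_sum g N.+1 \o T], so that the integral of [g] over this set is
nonnegative by invariance. *)
Lemma maximal_inequality g N : bounded_measurable g ->
  0 <= mean mu (fun x => g x * \1_[set y | 0 < max_sum g N y] x).
Proof.
move=> bg; set E := [set y | _].
have bM := bm_max_sum N bg; have [mM _] := bM.
have mE : measurable E.
  rewrite [E](_ : _ = max_sum g N @^-1` `]0, +oo[%classic).
    by rewrite -[X in measurable X]setTI; exact: mM.
  by apply/seteqP; split => x /=; rewrite in_itv /= andbT.
have bMT := bm_comp mT bM.
have bNM := bm_scale (-1) bMT.
apply: (@le_trans _ _
    (mean mu (fun x => max_sum g N x + (-1) * (max_sum g N \o T) x))).
  by rewrite mean_add// mean_scale// mean_shift// mulN1r subrr.
apply: mean_le; first exact: bm_add.
  exact: bm_mul bg (bm_indic mE).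
move=> x /=; rewrite mulN1r lerBlDr indicE.
have MN0 := max_sum_ge0 g N (T x).
case: (ltP 0 (max_sum g N x)) => [Mx|Mx]; last first.
  rewrite memNset ?mulr0 ?add0r ?(le_trans Mx)//.
  by rewrite /E /= => /lt_geF; rewrite Mx.
rewrite mem_set// mulr1; case: N Mx {E mE bM mM bMT bNM MN0} => [|N] /=.
  by rewrite ltxx.
rewrite lt_max ltxx /= => gM; rewrite ge_max (ltW _) /=; last first.
  by rewrite (lt_le_trans gM)// lerD2l max_sum_nondecreasing.
by rewrite lerD2l max_sum_nondecreasing.
Qed.

Hypothesis ergT : ergodic_measure mu T.

(** Where the maxima of the Birkhoff sums are unbounded is a strictly invariant
set.  By ergodicity it is null or full; the maximal inequality excludes
the second case when [g] has negative mean. *)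
Lemma max_sum_bounded g tau : bounded_measurable g -> mean mu g < 0 ->
  0 < tau -> exists j : nat, exists B : set X,
  [/\ measurable B, prob mu B < tau &
      forall x, ~ B x -> forall N, max_sum g N x <= j%:R].
Proof.
move=> bg g0 tau0.
pose E (j : nat) N := [set x | j%:R < max_sum g N x].
pose B j := \bigcup_N E j N.
have mE j N : measurable (E j N).
  have [mM _] := bm_max_sum N bg.
  rewrite [E j N](_ : _ = max_sum g N @^-1` `]j%:R, +oo[%classic).
    by rewrite -[X in measurable X]setTI; exact: mM.
  by apply/seteqP; split => x /=; rewrite in_itv /= andbT.
have mB j : measurable (B j) by exact: bigcupT_measurable.
have decB j : B j.+1 `<=` B j.
  by move=> x [N _ xE]; exists N => //; rewrite /E /= (le_lt_trans _ xE)// ler_nat.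
have [K gK] := bg.2.
(* Passing from [x] to [T x] changes the maxima by at most [K]. *)
have shiftK (j : nat) : exists i : nat, j%:R + K <= i%:R.
  exists (Num.truncn (j%:R + K)).+1; apply: ltW; exact: truncnS_gt.
have invB : T @^-1` (\bigcap_j B j) = \bigcap_j B j.
  apply/seteqP; split => x /= Bx j _.
    have [i ji] := shiftK j; have [N _ /= NE] := Bx i I.
    exists N.+1 => //; rewrite /E /= lt_max; apply/orP; right.
    have := gK x; rewrite ler_norml => /andP[gx _].
    by move: NE; rewrite /E /=; lra.
  have [i ji] := shiftK j; have [[|N] _ /= NE] := Bx i I.
    by move: NE; rewrite /E /= ltNge ler0n.
  exists N => //; move: NE; rewrite /E /= lt_max ltNge ler0n /= => NE.
  have := gK x; rewrite ler_norml => /andP[_ gx].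
  by rewrite /E /=; lra.
have mBoo : measurable (\bigcap_j B j) by exact: bigcapT_measurable.
have [B0|B1] := ergT mBoo invB.
  have [j Bj] := prob_nonincreasing_small mB decB B0 tau0.
  exists j, (B j); split => // x nBx N; rewrite leNgt; apply/negP => lt.
  by apply: nBx; exists N.
exfalso.
have K0 : 0 <= K by rewrite (le_trans _ (gK point))//.
(* The set where [max_sum g N] is positive exhausts the space, so that the
   maximal inequality passes to the limit and makes the mean of [g]
   nonnegative. *)
have E0 : mu (\bigcap_N ~` E 0%N N) = 0%E.
  rewrite -setC_bigcup probability_setC//=; last exact: (mB 0%N).
  have -> : mu (\bigcup_N E 0%N N) = 1%E.
    apply/eqP; rewrite eq_le probability_le1//=; last exact: (mB 0%N).
    rewrite -[X in (X <= _)%E]B1.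
    by apply: le_measure; rewrite ?inE//; [exact: (mB 0%N)|move=> x /(_ 0%N I)].
  by rewrite subee.
have [] := @prob_nonincreasing_small _ _ _ mu (fun N => ~` E 0%N N)
    (- mean mu g / (K + 1)) _ _ E0.
- by move=> N; exact: measurableC.
- move=> N x /= nE lt; apply: nE; rewrite /E /= in lt *.
  by rewrite (lt_le_trans lt)// max_sum_nondecreasing.
- by rewrite divr_gt0 ?oppr_gt0// ltr_wpDl.
move=> N; rewrite ltr_pdivlMr ?ltr_wpDl// => small.
have bE := bm_indic (mE 0%N N); have bCE := bm_indic (measurableC (mE 0%N N)).
have : mean mu (fun x => g x * \1_(E 0%N N) x) <=
    mean mu (fun x => g x + (K + 1) * \1_(~` E 0%N N) x).
  apply: mean_le.
  - exact: bm_mul.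
  - by apply: bm_add => //; exact: bm_scale.
  move=> x; rewrite !indicE in_setC.
  have := gK x; rewrite ler_norml => /andP[gx _].
  by case: (x \in E 0%N N) => /=; rewrite ?mulr1 ?mulr0 ?addr0//; lra.
rewrite mean_add// ?mean_scale//; last exact: bm_scale.
rewrite mean_indic; last exact: measurableC.
have := maximal_inequality N bg; rewrite -/(E 0%N N) => H1 H2.
have := le_trans H1 H2; lra.
Qed.

(** The function [g - (mean mu g + eta / 2)] has negative mean, so that its
Birkhoff sums are bounded outside of a small set; there they are eventually
below [n * (eta / 2)]. *)
Lemma birkhoff_sum_deviation g eta tau : bounded_measurable g ->
  0 < eta -> 0 < tau ->
  exists n0 : nat, forall n, (n0 <= n)%N ->
    prob mu [set x | n%:R * (mean mu g + eta) < birkhoff_sum g n x] < tau.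
Proof.
move=> bg eta0 tau0.
pose c := mean mu g + eta / 2.
pose g' x := g x + (- c).
have bg' : bounded_measurable g' by exact: (bm_add bg (bm_cst _)).
have g'0 : mean mu g' < 0.
  rewrite mean_add//; last exact: bm_cst.
  by rewrite mean_cst /c; lra.
have sumE n x : birkhoff_sum g' n x = birkhoff_sum g n x - n%:R * c.
  rewrite /birkhoff_sum big_split /= sumr_const card_ord.
  by rewrite mulNrn -(mulr_natl c).
have [j [B [mB Btau bdB]]] := max_sum_bounded bg' g'0 tau0.
exists (Num.truncn (j%:R / (eta / 2))).+1 => n n0n.
rewrite (le_lt_trans _ Btau)//; apply: prob_le => //.
  have [mS _] := bm_birkhoff_sum n bg.
  rewrite (_ : [set x | _] =
      birkhoff_sum g n @^-1` `]n%:R * (mean mu g + eta), +oo[%classic).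
    by rewrite -[X in measurable X]setTI; exact: mS.
  by apply/seteqP; split => x /=; rewrite in_itv /= andbT.
move=> x /= nx; apply: contrapT => /bdB /(_ n); apply/negP; rewrite -ltNge.
apply: (lt_le_trans _ (birkhoff_sum_le_max_sum _ _ _)); rewrite sumE.
have : j%:R / (eta / 2) < n%:R.
  by apply: (lt_le_trans (truncnS_gt _)); rewrite ler_nat.
rewrite ltr_pdivrMr ?divr_gt0// => jn.
rewrite /c; lra.
Qed.

End ergodic.

(** * Codes for itineraries and the entropy rate *)

Section conditional_code.
Context {R : realType} {d : measure_display} {O : measurableType d}.
Variable P : probability O R.

Lemma entropy_ge0 (A : finType) (Z : O -> A) : finite_measurable Z ->
  0 <= shannon_entropy P Z.
Proof.
move=> mZ; rewrite oppr_ge0; apply: sumr_le0 => a _ /=.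
by rewrite mulr_ge0_le0 ?prob_ge0// ln_le0// prob_le1.
Qed.

Lemma law_pair_sum (U A : finType) (Z : O -> U) (W : O -> A) u :
  finite_measurable Z -> finite_measurable W ->
  \sum_a law P (fun x => (Z x, W x)) (u, a) = law P Z u.
Proof.
move=> mZ mW; have mZW := finite_measurable_pair mZ mW.
rewrite (law_comp P fst u mZW).
rewrite (eq_big (fun ua : U * A => (ua.1 == u) && xpredT ua.2)
  (fun ua => law P (fun x => (Z x, W x)) (ua.1, ua.2))); last 2 first.
- by move=> ua; rewrite andbT.
- by case.
rewrite -(pair_big (fun v => v == u) xpredT
  (fun v a => law P (fun x => (Z x, W x)) (v, a)))/=.
by rewrite big_pred1_eq.
Qed.

(** Conversely, conditional entropy is approached by costs satisfying Kraft's
inequality: the optimal weights [p(u, a) / p(u)] are smoothed by [th] in order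
to be positive, so that their logarithms are bounded. *)
Lemma conditional_code (U A : finType) (Z : O -> U) (W : O -> A) (eta : R) :
  finite_measurable Z -> finite_measurable W -> 0 < eta ->
  exists c : U -> A -> R, [/\ forall u a, 0 <= c u a,
    forall u, \sum_a expR (- c u a) <= 1 &
    mean P (fun x => c (Z x) (W x)) <=
      shannon_entropy P (fun x => (Z x, W x)) - shannon_entropy P Z + eta].
Proof.
move=> mZ mW eta0; have mZW := finite_measurable_pair mZ mW.
pose a0 : A := W point; pose u0 : U := Z point.
have A0 : (0 < #|A|)%N by apply/card_gt0P; exists a0.
have U0 : (0 < #|U|)%N by apply/card_gt0P; exists u0.
pose th := eta / (#|U|%:R * #|A|%:R).
have th0 : 0 < th by rewrite divr_gt0// mulr_gt0 ?ltr0n.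
pose p2 ua := law P (fun x => (Z x, W x)) ua.
pose p1 u := law P Z u.
pose D u := p1 u + #|A|%:R * th.
have p20 ua : 0 <= p2 ua by exact: law_ge0.
have p10 u : 0 <= p1 u by exact: law_ge0.
have p2th ua : 0 < p2 ua + th by rewrite ltr_wpDl.
have D0 u : 0 < D u by rewrite ltr_wpDl// mulr_gt0 ?ltr0n.
have sumq u : \sum_a (p2 (u, a) + th) = D u.
  by rewrite big_split /= law_pair_sum// sumr_const -[th *+ _]mulr_natl.
exists (fun u a => ln (D u) - ln (p2 (u, a) + th)); split.
- move=> u a; rewrite subr_ge0 ler_ln ?posrE// -sumq (bigD1 a)//= lerDl.
  by apply: sumr_ge0 => b _; exact: ltW.
- move=> u; under eq_bigr => a _.
    rewrite opprB expRD expRN !lnK ?posrE//; over.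
  by rewrite -mulr_suml sumq divff// gt_eqF.
- rewrite (entropyE P mZW) (entropyE P mZ).
  rewrite (mean_finite P (fun ua => - ln (p2 ua)) mZW).
  rewrite (mean_finite P (fun u => - ln (p1 u)) mZ).
  rewrite (mean_add P (F := fun x => ln (D (Z x)))
    (G := fun x => - ln (p2 (Z x, W x) + th))); last 2 first.
  + exact: (bm_finite (fun u => ln (D u)) mZ).
  + exact: (bm_finite (fun ua => - ln (p2 ua + th)) mZW).
  rewrite (mean_finite P (fun u => ln (D u)) mZ).
  rewrite (mean_finite P (fun ua => - ln (p2 ua + th)) mZW).
  rewrite addrC -addrA; apply: lerD.
    apply: ler_sum => ua _; rewrite -/(p2 ua).
    have := p20 ua; rewrite le_eqVlt => /predU1P[<-|p0]; first by rewrite !mul0r.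
    by rewrite ler_pM2l// lerN2 ler_ln ?posrE// lerDl ltW.
  rewrite -sumrN -(_ : \sum_(u : U) #|A|%:R * th = eta); last first.
    rewrite sumr_const -[_ *+ _]mulr_natl /th; field.
    by rewrite !pnatr_eq0 -!lt0n A0; exact: U0.
  rewrite -big_split /=; apply: ler_sum => u _; rewrite -/(p1 u).
  have := p10 u; rewrite le_eqVlt => /predU1P[<-|p0].
    by rewrite !mul0r oppr0 add0r mulr_ge0// ltW.
  rewrite mulrN opprK -lerBlDl -mulrBr -ln_div ?posrE//.
  have -> : D u / p1 u = 1 + (#|A|%:R * th) / p1 u.
    by rewrite /D; field; rewrite gt_eqF.
  apply: (@le_trans _ _ (p1 u * ((#|A|%:R * th) / p1 u))).
    rewrite ler_pM2l// le_ln1Dx// (lt_le_trans (ltrN10 _))//.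
    by rewrite divr_ge0// mulr_ge0// ltW.
  by rewrite mulrC divfK// gt_eqF.
Qed.

End conditional_code.

Section sequential_cost.
Context {R : realType} {A : finType}.

(** A code that reads a word from left to right: [c past b] is the cost of the
letter [b] after the word [past]. *)
Fixpoint sequential_cost (c : seq A -> A -> R) (past s : seq A) : R :=
  if s is b :: s' then c past b + sequential_cost c (rcons past b) s' else 0.

(** Splitting off the first letter of a word, in terms of the sequence of its
letters. *)
Lemma sum_ffun_ordS n (F : seq A -> R) :
  \sum_(w : {ffun 'I_n.+1 -> A}) F (codom w) =
  \sum_b \sum_(w : {ffun 'I_n -> A}) F (b :: codom w).
Proof.
pose h (bw : A * {ffun 'I_n -> A}) : {ffun 'I_n.+1 -> A} :=
  [ffun i => if unlift ord0 i is Some j then bw.2 j else bw.1].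
pose h' (w : {ffun 'I_n.+1 -> A}) : A * {ffun 'I_n -> A} :=
  (w ord0, [ffun j => w (lift ord0 j)]).
have hK : cancel h h'.
  move=> [b w]; rewrite /h' /h ffunE unlift_none /=; congr pair.
  by apply/ffunP => j; rewrite !ffunE liftK.
have h'K : cancel h' h.
  move=> w; apply/ffunP => i; rewrite /h ffunE /=.
  by case: unliftP => [j ->|->]//; rewrite ffunE.
rewrite pair_bigA (reindex h) /=; last by exists h' => ? _; [exact: hK|exact: h'K].
apply: eq_bigr => -[b w] _ /=; congr F.
rewrite /codom /image_mem enum_ordSl /= ffunE unlift_none; congr cons.
by rewrite -map_comp; apply: eq_map => j /=; rewrite ffunE liftK.
Qed.

Lemma kraft_sequential (c : seq A -> A -> R) n past :
  (forall s, \sum_b expR (- c s b) <= 1) ->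
  \sum_(w : {ffun 'I_n -> A}) expR (- sequential_cost c past (codom w)) <= 1.
Proof.
move=> kraft; elim: n past => [|n IH] past.
  rewrite (eq_bigr (fun=> 1)) => [|w _].
    by rewrite sumr_const card_ffun card_ord expn0.
  have -> : codom w = [::] by apply/nilP; rewrite /nilp size_codom card_ord.
  by rewrite oppr0 expR0.
rewrite (sum_ffun_ordS n (fun s => expR (- sequential_cost c past s))).
apply: le_trans (kraft past); apply: ler_sum => b _ /=.
under eq_bigr => w _ do rewrite opprD expRD.
by rewrite -mulr_sumr ler_piMr ?expR_ge0.
Qed.

Lemma kraft_product n (c : 'I_n -> A -> R) :
  (forall k, \sum_b expR (- c k b) <= 1) ->
  \sum_(w : {ffun 'I_n -> A}) expR (- \sum_k c k (w k)) <= 1.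
Proof.
move=> kraft; under eq_bigr do rewrite -sumrN expR_sum.
rewrite -(bigA_distr_bigA (fun k b => expR (- c k b))).
apply: prodr_ile1 => k _; rewrite kraft andbT.
by apply: sumr_ge0 => b _; exact: expR_ge0.
Qed.

End sequential_cost.

Section entropy_rate.
Context {R : realType} {d : measure_display} {X : measurableType d}.
Variables (mu : probability X R) (T : X -> X) (A : finType) (f : X -> A).
Hypothesis mT : measurable_fun setT T.
Hypothesis invT : invariant_measure mu T.
Hypothesis mf : finite_measurable f.

Lemma finite_measurable_iter k : finite_measurable (fun x => f (iter k T x)).
Proof.
move=> a; rewrite -[X in measurable X]setTI.
exact: (measurable_iter mT k measurableT (mf a)).
Qed.

Lemma finite_measurable_itinerary n : finite_measurable (itinerary T f n).
Proof.
by apply: finite_measurable_ffun => k; exact: finite_measurable_iter.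
Qed.

Let H n := shannon_entropy mu (itinerary T f n).

Lemma entropy_itinerary_le n : H n <= H n.+1.
Proof.
rewrite /H (_ : itinerary T f n =
    (fun w : {ffun _} => [ffun k : 'I_n => w (widen_ord (leqnSn n) k)])
      \o itinerary T f n.+1).
  exact/entropy_comp_le/finite_measurable_itinerary.
by apply/funext => x; apply/ffunP => k; rewrite /= !ffunE.
Qed.

Lemma entropy_next_letter_le n :
  shannon_entropy mu (fun x => (itinerary T f n x, f (iter n T x))) <= H n.+1.
Proof.
rewrite /H (_ : (fun x => _) =
    (fun w : {ffun _} =>
      ([ffun k : 'I_n => w (widen_ord (leqnSn n) k)], w ord_max))
      \o itinerary T f n.+1).
  exact/entropy_comp_le/finite_measurable_itinerary.
apply/funext => x; rewrite /= ffunE; congr pair.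
by apply/ffunP => k; rewrite !ffunE.
Qed.

(** The infimum of the conditional entropies of the next letter given the
past. Each of them is the mean cost of a Markov code, which is why this
formula is used in place of the infimum of [H n / n]. *)
Definition entropy_rate : R := inf (range (fun n => H n.+1 - H n)).

Lemma entropy_rate_le n : entropy_rate <= H n.+1 - H n.
Proof.
apply: ge_inf; last by exists n.
by exists 0 => _ [m _ <-]; rewrite subr_ge0 entropy_itinerary_le.
Qed.

Lemma entropy_rate_itinerary_le n : n%:R * entropy_rate <= H n.
Proof.
elim: n => [|n IH].
  by rewrite mul0r; apply: entropy_ge0; exact: finite_measurable_itinerary.
have := entropy_rate_le n.
by rewrite -[n.+1%:R]natr1 mulrDl mul1r; lra.
Qed.

Lemma entropy_rate_adherent eta : 0 < eta ->
  exists m, H m.+1 - H m < entropy_rate + eta.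
Proof.
move=> eta0; have [|_ [m _ <-] lt] := @inf_adherent R
    (range (fun n => H n.+1 - H n)) eta eta0; last by exists m.
split; first by exists (H 1 - H 0); exists 0%N.
by exists 0 => _ [m _ <-]; rewrite subr_ge0 entropy_itinerary_le.
Qed.

Lemma codom_itinerary n x :
  codom (itinerary T f n x) = map f (traject T x n).
Proof.
apply: (@eq_from_nth _ (f point)).
  by rewrite size_codom card_ord size_map size_traject.
move=> i; rewrite size_codom card_ord => ilt; pose j := Ordinal ilt.
rewrite (nth_map x) ?size_traject// nth_traject//.
rewrite /codom /image_mem (nth_map j) ?size_enum_ord//.
by rewrite (nth_ord_enum j j) ffunE.
Qed.

Lemma sequential_cost_traject (c : seq A -> A -> R) j n x :
  sequential_cost c (map f (traject T x j))
      (map f (traject T (iter j T x) n)) =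
    \sum_(k < n) c (map f (traject T x (j + k))) (f (iter (j + k) T x)).
Proof.
elim: n j => [|n IH] j; first by rewrite big_ord0.
rewrite big_ord_recl /= addn0; congr +%R.
rewrite -map_rcons -trajectSr -iterS IH.
by apply: eq_bigr => k _; rewrite addSnnS.
Qed.

(** The cost of an itinerary for the Markov code of order [m] is, up to the
cost of the first [m] letters, a Birkhoff sum whose generator has mean close
to the entropy rate. This identity between codes and Birkhoff sums turns the
ergodic theorem into an asymptotic equipartition property. *)
Lemma markov_code eta : 0 < eta ->
  exists (C : R) (g : X -> R) (cost : forall n, {ffun 'I_n -> A} -> R),
  [/\ bounded_measurable g, forall x, 0 <= g x, mean mu g <= entropy_rate + eta,
      forall n, \sum_w expR (- cost n w) <= 1 &
      forall n x, cost n (itinerary T f n x) <= C + birkhoff_sum T g n x].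
Proof.
move=> eta0; have eta20 : 0 < eta / 2 by rewrite divr_gt0.
have [m Hm] := entropy_rate_adherent eta20.
have mZ := finite_measurable_itinerary (n := m); have mW := finite_measurable_iter m.
have [c [c0 ckraft cmean]] := conditional_code mu mZ mW eta20.
pose a0 : A := f point.
have A0 : (0 < #|A|)%N by apply/card_gt0P; exists a0.
have lnA : 0 <= ln #|A|%:R :> R by rewrite ln_ge0// ler1n.
(* The default letter [a0] is never read when [past] has at least [m] letters. *)
pose recent past : {ffun 'I_m -> A} :=
  [ffun i : 'I_m => nth a0 past (size past - m + i)].
pose cM past b := if (size past < m)%N then ln #|A|%:R else c (recent past) b.
pose g x := c (itinerary T f m x) (f (iter m T x)).
have g0 x : 0 <= g x by exact: c0.
have cM_traject k x : cM (map f (traject T x k)) (f (iter k T x)) =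
    if (k < m)%N then ln #|A|%:R else g (iter (k - m) T x).
  rewrite /cM size_map size_traject; case: ltnP => // mk.
  rewrite /g -iterD subnKC//; congr (c _ _); apply/ffunP => i.
  rewrite !ffunE size_map size_traject -iterD.
  have ik : (k - m + i < k)%N.
    by rewrite -{2}(subnK mk) ltn_add2l.
  by rewrite (nth_map x) ?size_traject// nth_traject// addnC.
exists (m%:R * ln #|A|%:R), g, (fun n w => sequential_cost cM [::] (codom w)).
split => //.
- exact: (bm_finite (fun ua => c ua.1 ua.2) (finite_measurable_pair mZ mW)).
- have := entropy_next_letter_le m; rewrite -/(H m) in cmean.
  by move: Hm cmean; rewrite /g; lra.
- move=> n; apply: kraft_sequential => s; rewrite /cM; case: (size s < m)%N => //.
  rewrite expRN lnK ?posrE ?ltr0n//.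
  by rewrite sumr_const -[_ *+ _]mulr_natl divff// pnatr_eq0 -lt0n.
- move=> n x; rewrite codom_itinerary.
  rewrite (sequential_cost_traject cM 0 n x) /=.
  under eq_bigr => k _ do rewrite add0n cM_traject.
  case: (leqP m n) => [mn|nm]; last first.
    apply: ler_wpDr; first by apply: sumr_ge0 => k _; exact: g0.
    apply: (@le_trans _ _ (\sum_(k < n) ln #|A|%:R)).
      by apply: ler_sum => k _; rewrite (ltn_trans (ltn_ord k)).
    rewrite sumr_const card_ord -[_ *+ _]mulr_natl ler_wpM2r// ler_nat.
    exact: ltnW.
  rewrite -(subnKC mn) big_split_ord /=; apply: lerD.
    rewrite (eq_bigr (fun=> ln #|A|%:R)) => [|k _]; last by rewrite ltn_ord.
    by rewrite sumr_const card_ord -[_ *+ _]mulr_natl.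
  rewrite addnC /birkhoff_sum big_split_ord /=.
  apply: ler_wpDr; first by apply: sumr_ge0 => k _; exact: g0.
  apply: ler_sum => k _; rewrite ltnNge leq_addr /=.
  by rewrite addKn.
Qed.

Lemma entropy_itinerary_le_rate eta : 0 < eta ->
  exists C, forall n, H n <= C + n%:R * (entropy_rate + eta).
Proof.
move=> /markov_code[C [g [cost [bg g0 gmean kraft costg]]]].
exists C => n; have mI := finite_measurable_itinerary (n := n).
apply: le_trans (entropy_le_cost mu mI (kraft n)) _.
have bS := bm_birkhoff_sum mT n bg.
apply: (@le_trans _ _ (mean mu (fun x => C + birkhoff_sum T g n x))).
  apply: mean_le => //; first exact: (bm_finite (cost n) mI).
  exact: (bm_add (bm_cst C) bS).
rewrite mean_add//; last exact: bm_cst.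
by rewrite mean_cst mean_birkhoff_sum// lerD2l ler_wpM2l.
Qed.

Lemma partition_entropyE : partition_entropy mu T f = entropy_rate%:E.
Proof.
apply/cvg_lim => //; apply: cvg_EFin; first exact: nearW.
apply/cvgrPdist_le => /= e e0; have e20 : 0 < e / 2 by rewrite divr_gt0.
have [C HC] := entropy_itinerary_le_rate e20.
near=> n; rewrite -/(H n).
have n0 : 0 < n%:R :> R by rewrite ltr0n; near: n; exact: nbhs_infty_gt.
have nC : C / (e / 2) <= n%:R by near: n; exact: nbhs_infty_ger.
move: nC; rewrite ler_pdivrMr// => nC.
have := entropy_rate_itinerary_le n; have := HC n => H1 H2.
rewrite ler_norml; apply/andP; split.
  rewrite lerNl opprB lerBlDl ler_pdivrMl// (le_trans H1)//.
  by move: nC; rewrite !mulrDr; lra.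
rewrite lerBlDl; apply: ler_wpDr; first exact: ltW.
by rewrite ler_pdivlMl.
Unshelve. all: by end_near. Qed.

End entropy_rate.

(** * Partitions of a compact metric space *)

Section metric_partitions.
Context {R : realType} {d : measure_display} {X : measurableMetricType d R}.
Hypothesis borel_X : borel X.

Lemma mdist_ball_open (x : X) (r : R) : open [set y | mdist x y < r].
Proof.
rewrite openE => y /= xy; apply/nbhs_ballP.
exists (r - mdist x y) => /=; first by rewrite subr_gt0.
move=> z; rewrite ballEmdist /= ltrBrDl; apply: le_lt_trans.
exact: metric_triangle.
Qed.

Lemma borel_open (U : set X) : open U -> measurable U.
Proof. by move=> oU; rewrite borel_X; exact: sub_sigma_algebra. Qed.

Lemma borel_continuous (T : X -> X) : continuous T -> measurable_fun setT T.
Proof.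
move=> /continuousP cT; apply: (measurability (@open X)) => // _ [U oU <-].
by rewrite setTI; apply: borel_open; exact: cT.
Qed.

Lemma small_partition (e : R) : compact [set: X] -> 0 < e ->
  exists (A : finType) (f : X -> A), finite_measurable f /\
    forall x y, f x = f y -> mdist x y < e.
Proof.
rewrite compact_cover => cptX e0; have e20 : 0 < e / 2 by rewrite divr_gt0.
have [|x _|s _ cov] := cptX X setT (fun c => [set y | mdist c y < e / 2]).
- by move=> c _; exact: mdist_ball_open.
- by exists x => //=; rewrite mdistxx.
pose l : seq X := finmap.enum_fset s.
pose near_centre (i : 'I_(size l)) := [set y | mdist (tnth (in_tuple l) i) y < e / 2].
have mball i : measurable (near_centre i).
  by apply: borel_open; exact: mdist_ball_open.
(* Two points with the same label are close to a common centre. *)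
exists {ffun 'I_(size l) -> bool}, (fun x => [ffun i => `[< near_centre i x >]]).
split.
  by apply: finite_measurable_ffun => i; exact: finite_measurable_asbool.
move=> x y fxy; have [c /= cs cx] := cov x I.
have /(tnthP (in_tuple l))[i ci] : c \in l by [].
have xi : near_centre i x by rewrite /near_centre /= -ci.
have /ffunP/(_ i) := fxy; rewrite !ffunE asboolT// => /esym/asboolP.
rewrite /near_centre /= -ci => cy.
rewrite (le_lt_trans (metric_triangle _ c _))// [e]splitr ltrD//.
by rewrite metric_sym.
Qed.

Variable mu : probability X R.

(** Membership of [x] in [B] can be read off any point close to [x], unless
[x] is in an exceptional set of small measure.  These sets form a
sigma-algebra that contains the open sets, which replaces an appeal to the
regularity of [mu]. *)
Definition robust (B : set X) : Prop := measurable B /\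
  forall eta : R, 0 < eta -> exists (B' V : set X) (rho : R),
  [/\ measurable B', measurable V, prob mu V < eta, 0 < rho &
      forall x y, ~ V x -> mdist x y < rho -> (B x <-> B' y)].

Lemma robust_open (U : set X) : open U -> robust U.
Proof.
move=> oU; split=> [|eta eta0]; first exact: borel_open.
(* The points at distance at least [r] from the complement of [U]. *)
pose W r := ~` \bigcup_(z in ~` U) [set y : X | mdist z y < r].
have mW r : measurable (W r).
  apply/measurableC/borel_open/bigcup_open => z _; exact: mdist_ball_open.
have mV j : measurable (U `\` W j.+1%:R^-1).
  by apply: measurableD => //; exact: borel_open.
have [||j Vj] := @prob_nonincreasing_small _ _ _ mu
    (fun j => U `\` W j.+1%:R^-1) eta mV _ _ eta0.
- move=> j x [Ux nWx]; split => // Wx; apply: nWx => -[z nUz /= zx].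
  apply: Wx; exists z => //=; apply: lt_le_trans zx _.
  by rewrite lef_pV2 ?posrE// ler_nat.
- rewrite (_ : \bigcap_n _ = set0) ?measure0// -subset0 => x Vx /=.
  have [Ux _] := Vx 0%N I.
  have : nbhs x U by apply: open_nbhs_nbhs.
  move=> /nbhs_ballP[r /= r0 rU].
  pose j := Num.truncn r^-1.
  have [_] := Vx j I; apply => -[z nUz /= zx]; apply: nUz; apply: rU.
  rewrite ballEmdist /= metric_sym; apply: lt_trans zx _.
  by rewrite invf_plt ?posrE// /j truncnS_gt.
pose r : R := j.+1%:R^-1; have r0 : 0 < r by rewrite invr_gt0.
exists (W (r / 2)), (U `\` W r), (r / 2); split; [exact: mW|exact: mV|exact: Vj|by rewrite divr_gt0|].
move=> x y nVx xy; split=> [Ux|Wy].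
  move=> -[z nUz /= zy]; apply: nVx; split=> // Wx; apply: Wx; exists z => //=.
  rewrite (le_lt_trans (metric_triangle _ y _))// [r]splitr ltrD//.
  by rewrite metric_sym.
by apply: contrapT => nUx; apply: Wy; exists x.
Qed.

Lemma robustC (B : set X) : robust B -> robust (~` B).
Proof.
move=> [mB rB]; split=> [|eta /rB]; first exact: measurableC.
move=> [B' [V [rho [mB' mV Veta rho0 BB']]]].
exists (~` B'), V, rho; split => //; first exact: measurableC.
by move=> x y nVx xy; have [H1 H2] := BB' x y nVx xy; split => nH ?; apply: nH; tauto.
Qed.

Lemma robust0 : robust set0.
Proof.
split=> // eta eta0; exists set0, set0, 1; split => //.
by rewrite /prob measure0.
Qed.

Lemma robustU (A B : set X) : robust A -> robust B -> robust (A `|` B).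
Proof.
move=> [mA rA] [mB rB]; split=> [|eta eta0]; first exact: measurableU.
have e20 : 0 < eta / 2 by rewrite divr_gt0.
have [A' [V [r [mA' mV Ve r0 AA']]]] := rA _ e20.
have [B' [W [s [mB' mW We s0 BB']]]] := rB _ e20.
exists (A' `|` B'), (V `|` W), (Num.min r s); split.
- exact: measurableU.
- exact: measurableU.
- by rewrite (le_lt_trans (probU_le _ mV mW))// [eta]splitr ltrD.
- by rewrite lt_min r0.
move=> x y nVWx; rewrite lt_min => /andP[xyr xys].
have [|H1 H2] := AA' x y _ xyr; first by move=> ?; apply: nVWx; left.
have [|H3 H4] := BB' x y _ xys; first by move=> ?; apply: nVWx; right.
by split => /=; tauto.
Qed.

Lemma robust_bigcup (F : nat -> set X) :
  (forall n, robust (F n)) -> robust (\bigcup_n F n).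
Proof.
move=> rF; have mF n : measurable (F n) by have [] := rF n.
have mUF : measurable (\bigcup_n F n) by exact: bigcupT_measurable.
split=> // eta eta0; have e20 : 0 < eta / 2 by rewrite divr_gt0.
pose G n := \big[setU/set0]_(i < n) F i.
have rG n : robust (G n).
  rewrite /G; elim: n => [|n IH]; first by rewrite big_ord0; exact: robust0.
  by rewrite big_ord_recr /=; exact: robustU.
have mG n : measurable (G n) by have [] := rG n.
have GE n x : G n x <-> exists2 i, (i < n)%N & F i x.
  rewrite /G -bigcup_mkord; split=> [[i /= lin Fx]|[i lin Fx]]; by exists i.
have mD n : measurable (\bigcup_n F n `\` G n) by exact: measurableD.
have [||n Dn] := @prob_nonincreasing_small _ _ _ mu
    (fun n => \bigcup_n F n `\` G n) (eta / 2) mD _ _ e20.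
- move=> n x [Fx nGx]; split => // /GE[i lin Fix]; apply: nGx; apply/GE.
  by exists i => //; rewrite ltnS ltnW.
- rewrite (_ : \bigcap_n _ = set0) ?measure0// -subset0 => x Dx /=.
  have [[i _ Fix] _] := Dx 0%N I; have [_] := Dx i.+1 I; apply; apply/GE.
  by exists i.
have [B' [V [rho [mB' mV Ve rho0 GB']]]] := (rG n).2 _ e20.
exists B', (V `|` (\bigcup_n F n `\` G n)), rho; split => //.
- exact: measurableU.
- by rewrite (le_lt_trans (probU_le _ mV (mD n)))// [eta]splitr ltrD.
move=> x y nx xy; have [|H1 H2] := GB' x y _ xy.
  by move=> Vx; apply: nx; left.
split=> [Fx|/H2/GE[i _ Fix]]; last by exists i.
by apply: H1; apply: contrapT => nGx; apply: nx; right.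
Qed.

Lemma robust_measurable (B : set X) : measurable B -> robust B.
Proof.
rewrite borel_X; apply: smallest_sub; last exact: robust_open.
split; [exact: robust0|by move=> A rA; rewrite setTD; exact: robustC|].
exact: robust_bigcup.
Qed.

(** The labels [f' y] are found by testing membership of [y] in the sets which
[robust] associates with the cells of [f]; they cannot be taken equal to
[f y], as the boundaries of the cells may have positive measure. *)
Lemma robust_labelling (A : finType) (f : X -> A) (eta : R) :
  finite_measurable f -> 0 < eta ->
  exists (f' : X -> A) (V : set X) (rho : R),
  [/\ finite_measurable f', measurable V, prob mu V < eta, 0 < rho &
      forall x y, ~ V x -> mdist x y < rho -> f' y = f x].
Proof.
move=> mf eta0.
have : exists (B' : A -> set X) (V : set X) (rho : R),
    [/\ forall a, measurable (B' a), measurable V, prob mu V < eta, 0 < rho &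
      forall x y, ~ V x -> mdist x y < rho ->
        forall a, a \in enum A -> (f x = a <-> B' a y)].
  elim: (enum A) eta eta0 => [|a s IH] eta eta0.
    exists (fun=> set0), set0, 1; split => //.
    by rewrite /prob measure0.
  have e20 : 0 < eta / 2 by rewrite divr_gt0.
  have [B' [V [r [mB' mV Ve r0 HB']]]] := IH _ e20.
  have [C [W [r' [mC mW We r'0 HC]]]] := (robust_measurable (mf a)).2 _ e20.
  exists (fun b => if b == a then C else B' b), (V `|` W), (Num.min r r').
  split.
  - by move=> b; case: ifP.
  - exact: measurableU.
  - by rewrite (le_lt_trans (probU_le _ mV mW))// [eta]splitr ltrD.
  - by rewrite lt_min r0.
  move=> x y nVWx; rewrite lt_min => /andP[xyr xyr'] b.
  rewrite inE; case: eqVneq => [->{b} _|ba /= bs].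
    by apply: HC => // Wx; apply: nVWx; right.
  by apply: HB' => // Vx; apply: nVWx; left.
move=> [B' [V [rho [mB' mV Ve rho0 HB']]]].
pose ind y := [ffun a => `[< B' a y >]].
pose dec (u : {ffun A -> bool}) := odflt (f point) [pick a | u a].
exists (dec \o ind), V, rho; split => //.
  apply: finite_measurable_comp; apply: finite_measurable_ffun => a.
  exact: finite_measurable_asbool.
move=> x y nVx xy; rewrite /dec /=.
case: pickP => [a|/(_ (f x))]; rewrite ffunE => /asboolP.
  by move=> /(HB' x y nVx xy a (mem_enum _ _)).
by case; apply/(HB' x y nVx xy (f x) (mem_enum _ _)).
Qed.

End metric_partitions.

(** * Three costs and two limits *)

Section costs.
Context {R : realType}.

(** The cost of guessing [a] to be [b]: when [a] is right the cost is small,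
and when it is wrong the cost is bounded. Being affine in the number of
errors, this bound can be averaged over time, unlike Fano's inequality in its
usual form, which calls for concavity. *)
Lemma mismatch_cost (A : finType) (a0 : A) (eta : R) : 0 < eta ->
  exists (cost : A -> A -> R) (L : R), [/\ 0 <= L,
    forall b, \sum_a expR (- cost a b) <= 1 &
    forall a b, cost a b <= eta + L * (a != b)%:R].
Proof.
move=> eta0; pose t := 1 - expR (- eta).
have t0 : 0 < t by rewrite subr_gt0 expR_lt1 oppr_lt0.
have t1 : t <= 1 by rewrite gerBl expR_ge0.
have A0 : (0 < #|A|)%N by apply/card_gt0P; exists a0.
have At0 : 0 < #|A|%:R / t by rewrite divr_gt0 ?ltr0n.
pose L := ln (#|A|%:R / t).
exists (fun a b => if a == b then eta else L), L.
have L0 : 0 <= L.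
  by rewrite ln_ge0// ler_pdivlMr// mul1r (le_trans t1)// ler1n.
split=> // [b|a b]; last first.
  by case: eqVneq => _ /=; rewrite ?mulr0 ?mulr1 ?addr0// lerDr ltW.
rewrite (bigD1 b)//= eqxx (eq_bigr (fun=> t / #|A|%:R)) => [|a ab]; last first.
  by rewrite (negbTE ab) expRN lnK ?posrE// invf_div.
rewrite sumr_const -[_ *+ _]mulr_natl.
have -> : expR (- eta) = 1 - t by rewrite /t subKr.
rewrite -lerBrDl subKr mulrCA ger_pMr// ler_pdivrMr ?ltr0n// mul1r ler_nat.
exact: max_card.
Qed.

(** A code that first names one of the codes [c i]. Its weights are the
averages of theirs. *)
Lemma uniform_mixture_cost (I : eqType) (W : finType) (s : seq I)
    (c : I -> W -> R) :
  (0 < size s)%N -> (forall i, \sum_w expR (- c i w) <= 1) ->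
  exists cost : W -> R, \sum_w expR (- cost w) <= 1 /\
    forall i w, i \in s -> cost w <= ln (size s)%:R + c i w.
Proof.
move=> s0 kraft; have N0 : 0 < (size s)%:R :> R by rewrite ltr0n.
pose Q w := (size s)%:R^-1 * \sum_(i <- s) expR (- c i w).
have leQ i w : i \in s -> (size s)%:R^-1 * expR (- c i w) <= Q w.
  move=> iS; rewrite /Q ler_pM2l ?invr_gt0// (big_rem i)//= lerDl.
  by apply: sumr_ge0 => j _; exact: expR_ge0.
have Q0 w : 0 < Q w.
  case: s s0 N0 @Q leQ => // i s _ N0 Q leQ.
  apply: lt_le_trans (leQ i w (mem_head _ _)).
  by rewrite mulr_gt0 ?invr_gt0// expR_gt0.
exists (fun w => - ln (Q w)); split=> [|i w iS].
  under eq_bigr do rewrite opprK lnK ?posrE//.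
  rewrite /Q -mulr_sumr exchange_big /= ler_pdivrMl// mulr1.
  rewrite -[X in _ <= X]mulr1 -sum1_size natr_sum mulr_suml.
  by apply: ler_sum => i _; rewrite mul1r.
rewrite lerNl opprD -lnV ?posrE// -[- c i w]expRK -lnM ?posrE ?invr_gt0 ?expR_gt0//.
by rewrite ler_ln ?posrE ?leQ ?Q0 ?mulr_gt0 ?invr_gt0 ?expR_gt0.
Qed.

Lemma card_le_cost (W : finType) (c : W -> R) (K : R) :
  \sum_w expR (- c w) <= 1 ->
  #|[set w | c w <= K]%SET|%:R <= expR K.
Proof.
move=> kraft; rewrite -[X in _ <= X]mulr1 -ler_pdivrMl ?expR_gt0//.
rewrite -expRN; apply: le_trans kraft.
rewrite [leRHS](bigID (fun w => c w <= K)) /=.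
apply: ler_wpDr; first by apply: sumr_ge0 => w _; exact: expR_ge0.
rewrite mulrC mulr_natl cardsE -sumr_const.
by apply: ler_sum => w; rewrite unfold_in /= => cK; rewrite ler_expR lerN2.
Qed.

End costs.

Section limits.
Context {R : realType}.
Local Open Scope ereal_scope.

Lemma limn_esup_le (u : (\bar R)^nat) (l : \bar R) n0 :
  (forall n, (n0 <= n)%N -> u n <= l) -> limn_esup u <= l.
Proof.
move=> ul; apply: (@le_trans _ _ (ereal_sup (u @` [set n | (n0 <= n)%N]))).
  apply: ereal_inf_lbound; exists [set n | (n0 <= n)%N] => //.
  by exists n0.
by apply: ge_ereal_sup => _ [n /= n0n <-]; exact: ul.
Qed.

Lemma limn_esup_ge (u : (\bar R)^nat) (l : \bar R) n0 :
  (forall n, (n0 <= n)%N -> l <= u n) -> l <= limn_esup u.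
Proof.
move=> ul; apply: le_ereal_inf_tmp => _ [S [n1 _ n1S] <-].
apply: le_ereal_sup_tmp; exists (u (maxn n0 n1)).
  by exists (maxn n0 n1) => //; apply: n1S; rewrite /= leq_maxr.
by apply: ul; rewrite leq_maxl.
Qed.

Lemma cvg_ereal_sup_at_right (F : R -> \bar R) (S : set (\bar R)) :
  S !=set0 -> (forall e, (0 < e)%R -> F e <= ereal_sup S) ->
  (forall s, S s -> exists r : R, s = r%:E /\
    forall eta, (0 < eta)%R -> exists2 e0, (0 < e0)%R &
      forall e, (0 < e < e0)%R -> (r - eta)%:E <= F e) ->
  F e @[e --> 0%R^'+] --> ereal_sup S.
Proof.
move=> [s0 Ss0] upper lower.
have nearF r eta : S r%:E -> (0 < eta)%R ->
    \forall e \near 0%R^'+, (r - eta)%:E <= F e.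
  move=> Sr eta0; have [_ [[<-] /(_ eta eta0)[e0 e00 He]]] := lower _ Sr.
  near=> e; apply: He; apply/andP; split; first by near: e; exact: nbhs_right_gt.
  by near: e; exact: nbhs_right_lt.
have near_upper : \forall e \near 0%R^'+, F e <= ereal_sup S.
  by near=> e; apply: upper; near: e; exact: nbhs_right_gt.
have [r0 [s0E _]] := lower _ Ss0.
have r0S : r0%:E <= ereal_sup S by rewrite -s0E; exact: ereal_sup_ubound.
case supE : (ereal_sup S) r0S => [l| |] // r0S.
  have nearl eta : (0 < eta)%R -> \forall e \near 0%R^'+, (l - eta)%:E <= F e.
    move=> eta0; have eta20 : (0 < eta / 2)%R by rewrite divr_gt0.
    have [|s Ss] := @ub_ereal_sup_adherent R S _ eta20; first by rewrite supE.
    have [r [sE _]] := lower _ Ss; rewrite supE sE -EFinB lte_fin => lr.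
    rewrite sE in Ss; near=> e; apply: (@le_trans _ _ (r - eta / 2)%:E).
      by rewrite lee_fin; lra.
    by near: e; exact: nearF.
  apply/fine_cvgP; split.
    near=> e; rewrite fin_numElt; apply/andP; split.
      apply: (@lt_le_trans _ _ (l - 1)%:E); first by rewrite ltNyr.
      by near: e; exact: nearl.
    apply: (@le_lt_trans _ _ l%:E); last by rewrite ltry.
    by rewrite -supE; near: e.
  apply/cvgrPdist_le => eta eta0; near=> e.
  have H1 : (l - eta)%:E <= F e by near: e; exact: nearl.
  have H2 : F e <= l%:E by rewrite -supE; near: e.
  move: H1 H2 => /=; case: (F e) => [v| |]//=; rewrite !lee_fin => H1 H2.
  by rewrite ger0_norm ?subr_ge0// lerBlDr -lerBlDl.
apply/cvgeyPge => M.
have [s Ss] : exists2 s, S s & (M + 1)%:E < s.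
  by apply/ereal_sup_gtP; rewrite supE ltry.
have [r [sE _]] := lower _ Ss; rewrite sE lte_fin => Mr.
rewrite sE in Ss.
near=> e; apply: (@le_trans _ _ (r - 1)%:E); first by rewrite lee_fin; lra.
by near: e; apply: nearF.
Unshelve. all: by end_near. Qed.

End limits.

(** * Rate distortion *)

(** Dividing by [L + 1] covers the case where [L] is zero. *)
Lemma le_mul_div (R : realType) (L p s : R) : 0 <= L -> 0 <= p ->
  p <= s / (L + 1) -> L * p <= s.
Proof.
move=> L0 p0; rewrite ler_pdivlMr ?ltr_wpDl// mulrDr mulr1 mulrC => H.
by rewrite (le_trans _ H)// lerDl.
Qed.

Section inequalities.
Context {R : realType} {d : measure_display} {X : measurableMetricType d R}.
Variables (T : X -> X) (mu : probability X R).
Hypothesis mT : measurable_fun setT T.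
Hypothesis invT : invariant_measure mu T.

Lemma entropy_rate_ge0 (A : finType) (f : X -> A) : finite_measurable f ->
  0 <= entropy_rate mu T f.
Proof.
move=> mf; apply: lb_le_inf; first by eexists; exists 0%N.
by move=> _ [n _ <-]; rewrite subr_ge0 entropy_itinerary_le.
Qed.

Lemma prob_iter (V : set X) k : measurable V ->
  mu (iter k T @^-1` V) = mu V.
Proof.
move=> mV; elim: k => [//|k IH]; rewrite -IH.
rewrite -[RHS]invT; last first.
  by rewrite -[X in measurable X]setTI; exact: measurable_iter.
by congr (mu _); apply/funext => x /=; rewrite -iterSr.
Qed.

Section one_partition.
Variables (A : finType) (f : X -> A).
Hypothesis mf : finite_measurable f.
Let h := entropy_rate mu T f.

Definition representative (x0 : X) (a : A) : X := xget x0 [set x | f x = a].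

Lemma representativeK x0 x : f (representative x0 (f x)) = f x.
Proof. by rewrite /representative; case: xgetP => [y _ //|/(_ x) []]. Qed.

(** The process that replaces each point of the orbit by the representative
of its cell is a function of the itinerary. *)
Lemma rate_distortion_le_rate e :
  (forall x y, f x = f y -> mdist x y < e) ->
  (rate_distortion mu T e <= h%:E)%E.
Proof.
move=> fe; pose q := representative point.
apply/lee_addgt0Pr => eta eta0; have eta20 : 0 < eta / 2 by rewrite divr_gt0.
have [C HC] := entropy_itinerary_le_rate mT invT mf eta20.
pose n := (Num.truncn (C / (eta / 2))).+1.
have n0 : 0 < n%:R :> R by rewrite ltr0n.
have := truncnS_gt (C / (eta / 2)); rewrite -/n ltr_pdivrMr// => Cn.
pose X0 : {mfun X >-> X} :=
  HB.pack (@idfun X) (isMeasurableFun.Build _ _ _ _ idfun (@measurable_id _ X setT)).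
pose Yf x : n.-tuple X := [tuple q (f (iter k T x)) | k < n].
have mY : measurable_fun setT Yf.
  apply/measurable_fun_tnthP => k _ S mS; rewrite setTI.
  rewrite (_ : _ @^-1` _ = (fun x => f (iter k T x)) @^-1` (q @^-1` S)).
    apply: finite_measurable_preimage; exact: finite_measurable_iter.
  by apply/funext => x; rewrite /preimage /= tnth_mktuple.
pose Y : {mfun X >-> n.-tuple X} :=
  HB.pack Yf (isMeasurableFun.Build _ _ _ _ Yf mY).
apply: (@le_trans _ _ ((n%:R^-1)%:E * mutual_info mu X0 Y)%E).
  apply: ereal_inf_lbound; exists n, d, X, mu, X0, Y; split => //; split => //.
  rewrite -[leRHS](expectation_cst mu e).
  apply: le_expectation => x.
    by rewrite mulr_ge0// sumr_ge0// => k _; exact: mdist_ge0.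
  rewrite ler_pdivrMl// mulr_natl -[X in _ *+ X]card_ord -sumr_const.
  apply: ler_sum => k _; rewrite tnth_mktuple; apply/ltW/fe.
  by rewrite representativeK.
rewrite muleC lee_pdivrMr// -EFinD -EFinM.
apply: ge_ereal_sup => _ [B1 [B2 [a [b [ma mb ->]]]]].
have mI : finite_measurable (itinerary T f n) by exact: finite_measurable_itinerary.
rewrite lee_fin /finite_mutual_info.
have bYE : b \o Y = (fun w : {ffun 'I_n -> A} => b [tuple q (w k) | k < n])
    \o itinerary T f n.
  apply/funext => x /=; congr b; apply: eq_from_tnth => k.
  by rewrite !tnth_mktuple ffunE.
have mbY : finite_measurable (b \o Y).
  by rewrite bYE; exact: finite_measurable_comp.
have H1 : shannon_entropy mu (a \o X0) <=
    shannon_entropy mu (fun x => ((a \o X0) x, (b \o Y) x)).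
  exact: (entropy_comp_le mu fst
    (finite_measurable_pair (ma : finite_measurable (a \o X0)) mbY)).
have := entropy_comp_le mu
  (fun w : {ffun 'I_n -> A} => b [tuple q (w k) | k < n]) mI.
rewrite -bYE => H2; have := HC n; rewrite -/h => H3.
move: H1 H2 H3 Cn; rewrite !mulrDl !mulrDr; lra.
Qed.

(** Let the labels of the points [T^k X0] be guessed from the labels of the
[Y k]. By [robust_labelling] a wrong guess means that [T^k X0] is in a small
set or is far from [Y k]; Markov's inequality bounds the frequency of the
second event by the distortion. *)
Lemma rate_distortion_ge (borel_X : borel X) eta : 0 < eta ->
  exists2 e0, 0 < e0 & forall e, 0 < e < e0 ->
    ((h - eta)%:E <= rate_distortion mu T e)%E.
Proof.
(* One third for the letters guessed correctly, one for the exceptional set,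
   and one for the points that are far apart. *)
move=> eta0; pose s := eta / 3; have s0 : 0 < s by rewrite divr_gt0.
have [cost [L [L0 kraft cost_le]]] := mismatch_cost (f point) s0.
have L10 : 0 < L + 1 by rewrite ltr_wpDl.
have sL0 : 0 < s / (L + 1) by rewrite divr_gt0.
have [f' [V [rho [mf' mV Vs rho0 ff']]]] := robust_labelling borel_X mu mf sL0.
exists (rho * (s / (L + 1))); first by rewrite mulr_gt0.
move=> e /andP[e_gt0 e_lt].
apply: le_ereal_inf_tmp => _ [n [dW [W0 [P [X0 [Y [n0 [lawX0 distY] ->]]]]]]].
have n0R : 0 < n%:R :> R by rewrite ltr0n.
have mI : finite_measurable (itinerary T f n) by exact: finite_measurable_itinerary.
pose b (y : n.-tuple X) := [ffun k : 'I_n => f' (tnth y k)].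
have mb : finite_measurable b.
  apply: finite_measurable_ffun => k a; rewrite -[X in measurable X]setTI.
  exact: (measurable_tnth k measurableT (mf' a)).
have mX0 : measurable_fun setT X0 by exact: measurable_funPT.
have mY : measurable_fun setT Y by exact: measurable_funPT.
pose U := itinerary T f n \o X0; pose W := b \o Y.
have mU : finite_measurable U.
  by move=> u; rewrite -[X in measurable X]setTI; exact: (mX0 measurableT _ (mI u)).
have mW : finite_measurable W.
  by move=> w; rewrite -[X in measurable X]setTI; exact: (mY measurableT _ (mb w)).
have HU : shannon_entropy P U = shannon_entropy mu (itinerary T f n).
  by apply: eq_entropy => u; rewrite -lawX0//; exact: mI.
have kraftn (w : {ffun 'I_n -> A}) :
    \sum_(u : {ffun 'I_n -> A}) expR (- \sum_k cost (u k) (w k)) <= 1.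
  by apply: (kraft_product (c := fun k a => cost a (w k))) => k; exact: kraft.
have Hcond := conditional_entropy_le_cost P mU mW kraftn.
pose S k := (fun w => iter k T (X0 w)) @^-1` V.
have mS k : measurable (S k).
  rewrite -[X in measurable X]setTI.
  exact: (measurableT_comp (measurable_iter mT k) mX0 measurableT mV).
have PS k : prob P (S k) = prob mu V.
  rewrite /prob -(prob_iter k mV) -[in RHS]lawX0//.
  by rewrite -[X in measurable X]setTI; exact: measurable_iter.
pose E (k : 'I_n) := [set w | U w k <> W w k] `\` S k.
have mE k : measurable (E k).
  apply: measurableD => //; rewrite (_ : [set w | _] =
    (fun w => (U w, W w)) @^-1` [set uw : {ffun 'I_n -> A} * {ffun 'I_n -> A} | uw.1 k <> uw.2 k])//.
  by apply: finite_measurable_preimage; exact: finite_measurable_pair.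
have bS k : bounded_measurable (\1_(S k) : W0 -> R) by exact: bm_indic.
have bE k : bounded_measurable (\1_(E k) : W0 -> R) by exact: bm_indic.
have bSE : bounded_measurable (fun w => \sum_(k < n) (\1_(S k) w + \1_(E k) w : R)).
  by apply: bm_sum => k; exact: bm_add.
have bc : bounded_measurable (fun w => \sum_k cost (U w k) (W w k)).
  exact: (bm_finite (fun uw : {ffun 'I_n -> A} * {ffun 'I_n -> A} =>
    \sum_k cost (uw.1 k) (uw.2 k)) (finite_measurable_pair mU mW)).
have bSum : bounded_measurable (fun w => \sum_(k < n) (\1_(E k) w : R)).
  exact: bm_sum.
have far : mean P (fun w => \sum_(k < n) \1_(E k) w) * rho <= n%:R * e.
  have c0 : 0 <= n%:R^-1 * rho by rewrite mulr_ge0 ?invr_ge0// ltW.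
  suff : n%:R^-1 * rho * mean P (fun w => \sum_(k < n) (\1_(E k) w : R)) <= e.
    by rewrite -mulrA ler_pdivrMl// mulrC.
  rewrite -mean_scale// -lee_fin -expectation_mean; last exact: bm_scale.
  apply: le_trans distY; apply: le_expectation => w.
    by rewrite mulr_ge0// sumr_ge0// => k _; rewrite indicE.
  rewrite -mulrA ler_pM2l ?invr_gt0// mulr_sumr; apply: ler_sum => k _.
  rewrite indicE; case: (boolP (w \in E k)); last first.
    by rewrite mulr0 mdist_ge0.
  rewrite mulr1 inE => -[UW nS]; rewrite leNgt; apply/negP => near_Y.
  by apply: UW; rewrite /U /W /b /= !ffunE (ff' _ _ nS near_Y).
have Hcost : mean P (fun w => \sum_k cost (U w k) (W w k)) <=
    n%:R * s + L * (n%:R * prob mu V + mean P (fun w => \sum_(k < n) \1_(E k) w)).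
  apply: (@le_trans _ _ (mean P (fun w => n%:R * s +
      L * \sum_(k < n) (\1_(S k) w + \1_(E k) w)))).
    apply: mean_le => //.
      by apply: bm_add; [exact: bm_cst|exact: bm_scale].
    move=> w; rewrite mulr_sumr mulr_natl -[X in _ *+ X]card_ord -sumr_const.
    rewrite -big_split /=; apply: ler_sum => k _.
    apply: (le_trans (cost_le _ _)); rewrite lerD2l ler_wpM2l//.
    case: eqVneq => [_|UW] /=; first by rewrite addr_ge0// indicE.
    rewrite !indicE; case: (boolP (w \in S k)) => [_|/negP nS].
      by rewrite lerDl.
    rewrite mem_set ?add0r//; split; first exact/eqP.
    by move=> wS; apply: nS; rewrite inE.
  rewrite mean_add; [|exact: bm_cst|exact: bm_scale].
  rewrite mean_cst mean_scale// lerD2l ler_wpM2l//.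
  under eq_fun do rewrite big_split /=.
  rewrite mean_add//; last exact: bm_sum.
  rewrite lerD2r mean_sum// (eq_bigr (fun=> prob mu V)) => [|k _].
    by rewrite sumr_const card_ord mulr_natl.
  by rewrite mean_indic.
have Hrate := entropy_rate_itinerary_le mu mT mf n.
apply: (@le_trans _ _ ((n%:R^-1)%:E * (finite_mutual_info P U W)%:E)%E).
  rewrite -EFinM lee_fin ler_pdivlMl// /finite_mutual_info HU.
  have LV : L * prob mu V <= s.
    by apply: le_mul_div => //; [exact: prob_ge0|exact: ltW].
  set m := mean P (fun w => \sum_(k < n) \1_(E k) w) in far Hcost.
  have m0 : 0 <= m.
    rewrite -[leLHS](mean_cst P); apply: mean_le => // [|w]; first exact: bm_cst.
    by apply: sumr_ge0 => k _; rewrite indicE.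
  have Lm : L * (m / n%:R) <= s.
    apply: le_mul_div => //; first by rewrite divr_ge0.
    rewrite ler_pdivrMr// -(ler_pM2r rho0) (le_trans far)//.
    rewrite [leRHS](_ : _ = n%:R * (rho * (s / (L + 1)))); last by ring.
    by rewrite ler_pM2l// ltW.
  have {}Lm : L * m <= n%:R * s by rewrite mulrA ler_pdivrMr// [s * _]mulrC in Lm.
  have {}LV : n%:R * (L * prob mu V) <= n%:R * s by rewrite ler_pM2l.
  have etaE : eta = s + s + s by rewrite /s; lra.
  move: Hrate Hcond Hcost Lm LV; rewrite -/h -/m etaE !mulrBr !mulrDr mulrCA.
  lra.
rewrite lee_pmul2l//; last by rewrite lte_fin invr_gt0.
apply: ereal_sup_ubound; exists _, _, (itinerary T f n), b; split => //.
Qed.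

End one_partition.
End inequalities.

(** * Covering numbers *)

Section covering_numbers.
Context {R : realType} {d : measure_display} {X : measurableMetricType d R}.
Variables (T : X -> X) (mu : probability X R).
Hypothesis mT : measurable_fun setT T.
Hypothesis invT : invariant_measure mu T.
Hypothesis ergT : ergodic_measure mu T.
Variables (A : finType) (f : X -> A).
Hypothesis mf : finite_measurable f.
Let h := entropy_rate mu T f.

Lemma measurable_birkhoff_gt (g : X -> R) n c : bounded_measurable g ->
  measurable [set x | c < birkhoff_sum T g n x].
Proof.
move=> bg; have [mS _] := bm_birkhoff_sum mT n bg.
rewrite (_ : [set x | _] = birkhoff_sum T g n @^-1` `]c, +oo[%classic).
  by rewrite -[X in measurable X]setTI; exact: mS.
by apply/seteqP; split => x /=; rewrite in_itv /= andbT.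
Qed.

(** By the ergodic theorem most points have an itinerary whose cost for a
Markov code is at most [n * (h + eta)], and Kraft's inequality bounds the
number of these words.  One centre for each of them is enough. *)
Lemma avg_entropy_le_rate delta e : 0 < delta -> 0 < e ->
  (forall x y, f x = f y -> mdist x y < e / 2) ->
  (avg_entropy mu T delta e <= h%:E)%E.
Proof.
move=> delta0 e0 fe; apply/lee_addgt0Pr => eta eta0.
(* One third for the constant [C], one for the mean of [g] and one for the
   deviation of its Birkhoff sums. *)
pose s := eta / 3; have s0 : 0 < s by rewrite divr_gt0.
have [C [g [cost [bg g0 gmean kraft costg]]]] := markov_code mu mT mf s0.
have [n0 Hn0] := birkhoff_sum_deviation mT invT ergT bg s0 delta0.
apply: (@limn_esup_le _ _ _ (maxn n0 (Num.truncn (C / s)).+1)) => n.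
rewrite geq_max => /andP[n0n nC].
have npos : 0 < n%:R :> R by rewrite ltr0n (leq_trans _ nC).
have {}nC : C < s * n%:R.
  rewrite -ltr_pdivrMl// mulrC (lt_le_trans (truncnS_gt _))//.
  by rewrite ler_nat.
pose K := C + n%:R * (h + s + s).
pose Good := [set w | cost n w <= K]%SET.
pose centre (w : {ffun 'I_n -> A}) := xget point [set x | itinerary T f n x = w].
pose centres := [seq centre w | w <- enum Good].
have mI : finite_measurable (itinerary T f n) by exact: finite_measurable_itinerary.
have cover : avg_covering mu T n e delta centres.
  exists (itinerary T f n @^-1` [set w | w \in Good]); split.
  - exact: finite_measurable_preimage.
  - set G := _ @^-1` _; have mG : measurable G by exact: finite_measurable_preimage.
    rewrite prob_fin// lte_fin.
    have : prob mu (~` G) < delta.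
      apply: le_lt_trans (Hn0 n n0n); apply: prob_le.
      + exact: measurableC.
      + exact: measurable_birkhoff_gt.
      move=> x /negP; rewrite inE -ltNge /K /= => lt.
      have := costg n x; have : n%:R * (mean mu g + s) <= n%:R * (h + s + s).
        by rewrite ler_pM2l// lerD2r.
      by move: lt; lra.
    by rewrite probC//; lra.
  - move=> x /= xG; exists (centre (itinerary T f n x)).
      by rewrite /= map_f// mem_enum.
    rewrite /avg_ball /= /avg_dist.
    have cE : itinerary T f n (centre (itinerary T f n x)) = itinerary T f n x.
      by rewrite /centre; case: xgetP => [y _ //|/(_ x) []].
    apply: (@le_lt_trans _ _ (e / 2)); last first.
      by rewrite ltr_pdivrMr// ltr_pMr// ltr1n.
    rewrite ler_pdivrMl// mulr_natl -[X in _ *+ X]card_ord -sumr_const.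
    apply: ler_sum => k _; apply/ltW/fe.
    by have /ffunP/(_ k) := cE; rewrite !ffunE.
have size_le : (size centres)%:R <= expR K.
  by rewrite size_map -cardE; exact: card_le_cost.
have lneK_le : (lne (avg_covering_number mu T n e delta) <= K%:E)%E.
  have N_le : (avg_covering_number mu T n e delta <= (expR K)%:E)%E.
    apply: (@le_trans _ _ (size centres)%:R%:E); last by rewrite lee_fin.
    by apply: ereal_inf_lbound; exists centres.
  rewrite -[leRHS](expeRK) lee_lne//= in_itv/= ?leey ?andbT.
    apply: le_ereal_inf_tmp => _ [c _ <-]; by rewrite lee_fin.
  by rewrite lee_fin expR_ge0.
apply: (@le_trans _ _ ((n%:R^-1)%:E * K%:E)%E).
  by rewrite lee_pmul2l// lte_fin invr_gt0.
rewrite -EFinM -EFinD lee_fin ler_pdivrMl// /K.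
have -> : eta = s + s + s by rewrite /s; lra.
by move: nC; rewrite !mulrDr; lra.
Qed.

(** The cost used here first says which of two codes is used.  On the covered
set the first code names the centre [c] of a ball and corrects the labels of
its orbit; elsewhere the second one is a Markov code.  Comparing the mean cost
with the entropy of the itinerary gives
[a * ln (size s) >= n * (a * h - small)] for the measure [a] of the covered
set, so that the lower bound does not depend on [a]. *)
Lemma avg_entropy_ge (borel_X : borel X) delta eta : 0 < delta < 1 -> 0 < eta ->
  exists2 e0, 0 < e0 & forall e, 0 < e < e0 ->
    ((h - eta)%:E <= avg_entropy mu T delta e)%E.
Proof.
move=> /andP[delta0 delta1] eta0.
have delta10 : 0 < 1 - delta by rewrite subr_gt0.
(* Seven error terms are each at most [n * s], and their sum is divided by the
   measure of the covered set, which is larger than [1 - delta]. *)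
pose s := eta * (1 - delta) / 7.
have s0 : 0 < s by rewrite divr_gt0// mulr_gt0.
have h0 : 0 <= h by exact: entropy_rate_ge0.
have [r [L [L0 rkraft r_le]]] := mismatch_cost (f point) s0.
have L10 : 0 < L + 1 by rewrite ltr_wpDl.
have sL0 : 0 < s / (L + 1) by rewrite divr_gt0.
have [f' [V [rho [mf' mV Vs rho0 ff']]]] := robust_labelling borel_X mu mf sL0.
exists (rho * (s / (L + 1))); first by rewrite mulr_gt0.
move=> e /andP[e_gt0 e_lt].
have [C [g [cost [bg g0 gmean kraft costg]]]] := markov_code mu mT mf s0.
have [M gM] := bg.2.
have M0 : 0 <= M by rewrite (le_trans _ (gM point)).
have M10 : 0 < M + 1 by rewrite ltr_wpDl.
have sM0 : 0 < s / (M + 1) by rewrite divr_gt0.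
have [n0 Hn0] := birkhoff_sum_deviation mT invT ergT bg s0 sM0.
pose B := ln 2 + `|C|.
apply: (@limn_esup_ge _ _ _ (maxn n0 (Num.truncn (B / s)).+1)) => n.
rewrite geq_max => /andP[n0n nB].
have npos : 0 < n%:R :> R by rewrite ltr0n (leq_trans _ nB).
have {}nB : B <= s * n%:R.
  rewrite ltW// -ltr_pdivrMl// mulrC (lt_le_trans (truncnS_gt _))//.
  by rewrite ler_nat.
have mI : finite_measurable (itinerary T f n) by exact: finite_measurable_itinerary.
suff size_ge c : avg_covering mu T n e delta c ->
    expR (n%:R * (h - eta)) <= (size c)%:R.
  have N_ge : ((expR (n%:R * (h - eta)))%:E <= avg_covering_number mu T n e delta)%E.
    by apply: le_ereal_inf_tmp => _ [c /size_ge ? <-]; rewrite lee_fin.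
  apply: (@le_trans _ _ ((n%:R^-1)%:E * (n%:R * (h - eta))%:E)%E).
    by rewrite -EFinM lee_fin mulKf// gt_eqF.
  rewrite lee_pmul2l//; last by rewrite lte_fin invr_gt0.
  rewrite -[leLHS](expeRK) lee_lne//= in_itv/= ?leey ?andbT.
    by rewrite lee_fin expR_ge0.
  by rewrite (le_trans _ N_ge)// lee_fin expR_ge0.
move=> [G [mG muG Gc]].
have a_gt : 1 - delta < prob mu G by rewrite -lte_fin -prob_fin.
have a_le1 := prob_le1 mu mG.
have c0 : (0 < size c)%N.
  case: c Gc => // Gc; have G0 : G = set0.
    by rewrite -subset0 => x /Gc[].
  by move: a_gt; rewrite G0 /prob measure0 /= ltNge ltW.
have N0 : 0 < (size c)%:R :> R by rewrite ltr0n.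
have lnN0 : 0 <= ln (size c)%:R :> R by rewrite ln_ge0// ler1n.
pose ballcost z (w : {ffun 'I_n -> A}) := \sum_k r (w k) (f' (iter k T z)).
have ballkraft z : \sum_w expR (- ballcost z w) <= 1.
  by apply: (kraft_product (c := fun k b => r b (f' (iter k T z)))) => k; exact: rkraft.
have [cost1 [kraft1 cost1_le]] := uniform_mixture_cost c0 ballkraft.
have kraft2 (b : bool) : \sum_w expR (- (if b then cost1 else cost n) w) <= 1.
  by case: b.
have [cost2 [kraft3 cost2_le]] :=
  @uniform_mixture_cost _ _ _ [:: true; false] _ isT kraft2.
have Hn := entropy_le_cost mu mI kraft3.
pose D := [set x | n%:R * (mean mu g + s) < birkhoff_sum T g n x].
have mD : measurable D by exact: measurable_birkhoff_gt.
have MD : M * prob mu D <= s.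
  by apply: le_mul_div => //; [exact: prob_ge0|exact/ltW/Hn0].
have LV : L * prob mu V <= s.
  by apply: le_mul_div => //; [exact: prob_ge0|exact: ltW].
have Le : L * (e / rho) <= s.
  apply: le_mul_div => //; first by rewrite divr_ge0// ltW.
  by rewrite ler_pdivrMr// mulrC ltW.
have bV : bounded_measurable (\1_V : X -> R) by exact: bm_indic.
pose q := n%:R * (h + s + s).
have q0 : 0 <= q by rewrite mulr_ge0// !addr_ge0// ltW.
pose bound x := B + n%:R * s + n%:R * (L * (e / rho)) + q +
  ((ln (size c)%:R - q) * \1_G x + (n%:R * M) * \1_D x +
   L * birkhoff_sum T (\1_V) n x).
have mismatch z x : avg_dist T n z x < e -> ballcost z (itinerary T f n x) <=
    n%:R * s + n%:R * (L * (e / rho)) + L * birkhoff_sum T (\1_V) n x.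
  rewrite /avg_dist ltr_pdivrMl// => dist_lt.
  apply: (@le_trans _ _ (\sum_(k < n) (s + L * (\1_V (iter k T x) +
      mdist (iter k T z) (iter k T x) / rho)))).
    apply: ler_sum => k _; rewrite ffunE.
    apply: (le_trans (r_le _ _)); rewrite lerD2l ler_wpM2l//.
    case: eqVneq => [_|fz] /=.
      by rewrite addr_ge0 ?indicE// divr_ge0 ?mdist_ge0// ltW.
    rewrite indicE; case: (boolP (_ \in V)) => [_|/negP nV].
      by rewrite lerDl divr_ge0 ?mdist_ge0// ltW.
    rewrite add0r ler_pdivlMr// mul1r leNgt; apply/negP => near_z.
    move: fz; rewrite (ff' (iter k T x)) ?eqxx//.
      by move=> ?; apply: nV; rewrite inE.
    by rewrite metric_sym.
  rewrite big_split /= sumr_const card_ord -[_ *+ _]mulr_natl -addrA lerD2l.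
  rewrite -mulr_sumr big_split /= -mulr_suml mulrDr addrC /birkhoff_sum lerD2l.
  rewrite [leRHS]mulrCA ler_wpM2l// [leRHS]mulrA ler_pM2r ?invr_gt0//.
  exact: ltW.
have S0 x : 0 <= birkhoff_sum T (\1_V) n x :> R.
  by apply: sumr_ge0 => k _; rewrite indicE.
have pointwise x : cost2 (itinerary T f n x) <= bound x.
  have LS0 : 0 <= L * birkhoff_sum T (\1_V) n x by rewrite mulr_ge0.
  have LE0 : 0 <= n%:R * (L * (e / rho)).
    by rewrite !mulr_ge0 ?invr_ge0//; exact: ltW.
  have NS0 : 0 <= n%:R * s by rewrite mulr_ge0// ltW.
  have NM0 : 0 <= n%:R * M by rewrite mulr_ge0.
  have C1 : C <= `|C| by exact: ler_norm.
  have C2 : 0 <= `|C| by [].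
  rewrite /bound /B indicE; case: (boolP (x \in G)) => [xG|_] /=.
    have [z zc zx] := Gc x (set_mem xG).
    have := cost2_le true (itinerary T f n x) (mem_head _ _).
    have := cost1_le z (itinerary T f n x) zc.
    have := mismatch z x zx.
    have D1 : 0 <= n%:R * M * \1_D x by rewrite mulr_ge0// indicE.
    by rewrite /=; lra.
  have := cost2_le false (itinerary T f n x) isT; rewrite /=.
  have := costg n x.
  have : birkhoff_sum T g n x <= q + n%:R * M * \1_D x.
    rewrite indicE; case: (boolP (x \in D)) => [_|/negP nD] /=.
      rewrite mulr1; apply: (@le_trans _ _ (n%:R * M)); last by rewrite lerDr.
      rewrite mulr_natl -[X in _ *+ X]card_ord -sumr_const.
      by apply: ler_sum => k _; rewrite (le_trans (ler_norm _)).
    rewrite mulr0 addr0 leNgt; apply/negP => lt; apply: nD; rewrite inE /D /=.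
    apply: le_lt_trans lt; rewrite ler_pM2l// lerD2r //.
  by rewrite mulr0; lra.
have bG : bounded_measurable (\1_G : X -> R) by exact: bm_indic.
have bD : bounded_measurable (\1_D : X -> R) by exact: bm_indic.
have bSV := bm_birkhoff_sum mT n bV.
have bGl := bm_scale (ln (size c)%:R - q) bG.
have bDl := bm_scale (n%:R * M) bD.
have bSl := bm_scale L bSV.
have bGD := bm_add bGl bDl.
have mean_bound : mean mu bound = B + n%:R * s + n%:R * (L * (e / rho)) + q +
    ((ln (size c)%:R - q) * prob mu G + (n%:R * M) * prob mu D +
     L * (n%:R * prob mu V)).
  rewrite /bound mean_add; [|exact: bm_cst|exact: bm_add].
  rewrite mean_cst mean_add// mean_add// !mean_scale// !mean_indic//.
  by rewrite mean_birkhoff_sum// mean_indic.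
have bbound : bounded_measurable bound.
  by apply: bm_add; [exact: bm_cst|exact: bm_add].
have := mean_le mu (bm_finite cost2 mI) bbound pointwise.
rewrite mean_bound => Hmean.
have Hrate := entropy_rate_itinerary_le mu mT mf n.
have total := le_trans (le_trans Hrate Hn) Hmean.
rewrite -/h in total.
set a := prob mu G in total a_gt a_le1.
have a0 : 0 < a by rewrite (lt_trans delta10).
have nMD : n%:R * M * prob mu D <= n%:R * s by rewrite -mulrA ler_pM2l.
have nLV : L * (n%:R * prob mu V) <= n%:R * s by rewrite mulrCA ler_pM2l.
have nLe : n%:R * (L * (e / rho)) <= n%:R * s by rewrite ler_pM2l.
have key : a * (n%:R * (h - eta)) <= a * ln (size c)%:R.
  have s7 : n%:R * (7 * s) <= n%:R * (a * eta).
    rewrite ler_pM2l// [leRHS]mulrC.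
    have -> : 7 * s = eta * (1 - delta) by rewrite /s; lra.
    by rewrite ler_pM2l// ltW.
  have na : 0 <= n%:R * (a * s) by rewrite !mulr_ge0// ltW.
  move: total nB nMD nLV nLe s7 na.
  rewrite /q !mulrBr !mulrBl !mulrDr !mulrDl; lra.
rewrite -[leRHS]lnK ?posrE// ler_expR.
by rewrite -(ler_pM2l a0).
Qed.

End covering_numbers.

(** * Convergence to the entropy *)

Theorem theorem3 (R : realType) (d : measure_display)
    (X : measurableMetricType d R) (T : X -> X) (mu : probability X R)
    (borel_X : borel X) (compact_X : compact [set: X])
    (continuous_T : continuous T) (invariant_mu : invariant_measure mu T)
    (ergodic_mu : ergodic_measure mu T) (delta : R)
    (delta01 : 0 < delta < 1) :
  rate_distortion mu T eps @[eps --> 0^'+] --> ks_entropy mu T /\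
  avg_entropy mu T delta eps @[eps --> 0^'+] --> ks_entropy mu T.
Proof.
have mT := borel_continuous borel_X continuous_T.
have rate_le (A : finType) (f : X -> A) : finite_measurable f ->
    ((entropy_rate mu T f)%:E <= ks_entropy mu T)%E.
  move=> mf; apply: ereal_sup_ubound; exists A, f; split => //.
  by rewrite partition_entropyE.
have ks_nonempty : [set r | exists (A : finType) (f : X -> A),
    finite_measurable f /\ r = partition_entropy mu T f] !=set0.
  eexists; exists unit, (fun=> tt); split; last by [].
  by move=> [] /=; rewrite preimage_cst mem_set.
split; apply: cvg_ereal_sup_at_right => //.
- move=> e e0; have [A [f [mf fe]]] := small_partition borel_X compact_X e0.
  exact: le_trans (rate_distortion_le_rate mT invariant_mu mf fe) (rate_le _ _ mf).
- move=> _ [A [f [mf ->]]]; exists (entropy_rate mu T f).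
  split; first exact: partition_entropyE.
  by move=> eta; exact: rate_distortion_ge.
- move=> e e0; have e20 : 0 < e / 2 by rewrite divr_gt0.
  have [A [f [mf fe]]] := small_partition borel_X compact_X e20.
  have /andP[delta0 _] := delta01.
  exact: le_trans (avg_entropy_le_rate mT invariant_mu ergodic_mu mf delta0 e0 fe)
    (rate_le _ _ mf).
- move=> _ [A [f [mf ->]]]; exists (entropy_rate mu T f).
  split; first exact: partition_entropyE.
  by move=> eta; exact: avg_entropy_ge.
Qed.
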